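(* Let $Y = 1 + Z$ where $Z$ is an exponential random variable with rate parameter $1$. Then for every $n\geq1$, the $n$-th moment $m_n(Y)=E(Y^n)$ equals the number of positroids on $[n]$, and the $n$-th free cumulant $k_n(Y)$ equals the number of connected positroids on $[n]$.
   Context: The free cumulants $k_1,k_2,\dots$ of a random variable with moments $m_1,m_2,\dots$ are the numbers determined by $m_n = \sum_{\{S_1,\dots,S_k\}\in NC_n} k_{\#S_1}k_{\#S_2}\cdots k_{\#S_k}$ for all $n\geq1$, where $NC_n$ is the set of non-crossing partitions of $[n]$ (partitions into nonempty blocks with no $a,b,c,d$ in cyclic order such that $a,c$ lie in one block and $b,d$ in a different block). A matroid $M$ on $[n]$ is a positroid if there is a real $d\times n$ matrix of rank $d$ with all maximal minors nonnegative whose column matroid is $M$ (column $i$ corresponding to element $i$). A matroid is connected if it is not a direct sum of two matroids on nonempty ground sets. *)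

(* Defs.v *)
From HB Require Import structures.
From mathcomp Require Import all_boot all_order all_algebra.
From mathcomp Require Import all_classical all_reals all_analysis.

Set Implicit Arguments.
Unset Strict Implicit.
Unset Printing Implicit Defensive.

Import Order.TTheory GRing.Theory Num.Theory.

Local Open Scope ring_scope.

(** * Free cumulants *)

(* [a, b, c, d] are distinct and occur in this cyclic order. *)
Definition cyclically_ordered (a b c d : nat) : bool :=
  has (fun i => sorted ltn (rot i [:: a; b; c; d])) (iota 0 4).

Definition noncrossing (n : nat) (P : {set {set 'I_n}}) : bool :=
  [forall A in P, forall B in P, (A != B) ==>
    ~~ [exists a in A, exists b in B, exists c in A, exists d in B,
         cyclically_ordered a b c d]].

Definition NC (n : nat) : {set {set {set 'I_n}}} :=
  [set P | finset.partition P [set: 'I_n]%SET & noncrossing P]%SET.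

(* Only the values of [m] and [k] at positive indices matter. *)
Definition is_free_cumulants (R : comPzRingType) (m k : nat -> R) : Prop :=
  forall n : nat, (0 < n)%N -> m n = \sum_(P in NC n) \prod_(S in P) k #|S|.

Section FreeCumulants.
Variable R : comPzRingType.
Implicit Types m k : nat -> R.

Lemma top_partition_NC n : (0 < n)%N -> [set [set: 'I_n]]%SET \in NC n.
Proof.
move=> n0; rewrite inE; apply/andP; split.
  apply/and3P; split.
  - by rewrite finset.cover1.
  - by apply/finset.trivIsetP => A B /set1P -> /set1P ->; rewrite eqxx.
  - by apply/set1P => /setP /(_ (Ordinal n0)); rewrite !inE.
by apply/'forall_implyP => A /set1P ->; apply/'forall_implyP => B /set1P ->;
  rewrite eqxx.
Qed.

Lemma NC_block_lt n (P : {set {set 'I_n}}) (S : {set 'I_n}) :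
  P \in NC n -> P != [set [set: 'I_n]]%SET -> S \in P -> (0 < #|S| < n)%N.
Proof.
rewrite inE => /andP[/and3P[covP trP P0] _] Pneq SP.
have S0 : S != finset.set0 by apply: contraNneq P0 => <-.
rewrite card_gt0 S0 /= ltn_neqAle -[X in (_ <= X)%N](card_ord n) max_card andbT.
apply: contraNneq Pneq => cS.
have ST : S = [set: 'I_n]%SET.
  by apply/eqP; rewrite eqEcard finset.subsetT cardsT card_ord cS leqnn.
rewrite finset.eqEsubset finset.sub1set -ST SP andbT; apply/fintype.subsetP => B BP.
apply/set1P/eqP; apply: contraT => BS.
move/finset.trivIsetP: trP => /(_ _ _ BP SP BS).
rewrite ST -setI_eq0 finset.setIT => /eqP B0.
by rewrite -B0 BP in P0.
Qed.

Lemma NC_sum_top k n : (0 < n)%N ->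
  \sum_(P in NC n) \prod_(S in P) k #|S| =
  k n + \sum_(P in NC n | P != [set [set: 'I_n]]%SET) \prod_(S in P) k #|S|.
Proof.
move=> n0; rewrite (bigD1 _ (top_partition_NC n0)) /=.
by rewrite finset.big_set1 cardsT card_ord.
Qed.

Lemma NC_sum_proper k k' n : (forall i, (0 < i < n)%N -> k i = k' i) ->
  \sum_(P in NC n | P != [set [set: 'I_n]]%SET) \prod_(S in P) k #|S| =
  \sum_(P in NC n | P != [set [set: 'I_n]]%SET) \prod_(S in P) k' #|S|.
Proof.
move=> kk'; apply: eq_bigr => P /andP[PNC Pneq]; apply: eq_bigr => S SP.
exact/kk'/(NC_block_lt PNC Pneq SP).
Qed.

Lemma free_cumulants_uniq m k k' :
  is_free_cumulants m k -> is_free_cumulants m k' ->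
  forall n, (0 < n)%N -> k n = k' n.
Proof.
move=> mk mk'; elim/ltn_ind => n IH n0.
have := mk _ n0; rewrite (mk' _ n0) !NC_sum_top // (@NC_sum_proper k k').
  by move/addIr => ->.
by move=> i /andP[i0 lt_in]; exact: IH.
Qed.

Lemma free_cumulants_exist m : exists k, is_free_cumulants m k.
Proof.
pose fc := fix fc (N : nat) : nat -> R := if N is N'.+1 then
  fun n => if (n <= N')%N then fc N' n else
    m N'.+1 - \sum_(P in NC N'.+1 | P != [set [set: 'I_N'.+1]]%SET)
                \prod_(S in P) fc N' #|S| else fun=> 0.
have fcE N n : (n <= N)%N -> fc N n = fc n n.
  elim: N => [|N IH]; first by rewrite leqn0 => /eqP ->.
  by rewrite leq_eqVlt ltnS => /predU1P[->//|nN]; rewrite /= nN IH.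
exists (fun n => fc n n) => -[//|n] _; rewrite (NC_sum_top (fun n => fc n n)) //=.
rewrite ltnn (@NC_sum_proper (fun n => fc n n) (fc n)) ?subrK //.
by move=> i /andP[_]; rewrite ltnS => /fcE ->.
Qed.

End FreeCumulants.

Definition free_cumulant (R : comPzRingType) (m : nat -> R) : nat -> R :=
  projT1 (cid (free_cumulants_exist m)).

Lemma free_cumulantP (R : comPzRingType) (m : nat -> R) :
  is_free_cumulants m (free_cumulant m).
Proof. exact: projT2 (cid (free_cumulants_exist m)). Qed.

(** * Moments *)

(* [fine] sends infinite expectations to [0]. *)
Definition moment d (T : measurableType d) (R : realType) (P : probability T R)
  (Y : T -> R) (n : nat) : R := fine 'E_P[fun x => (Y x ^+ n)%R]%E.

(** * Matroids *)

(* Independent-set axioms, for a family [I] of subsets of the ground set [E]. *)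
Definition matroid_axioms (T : finType) (E : {set T}) (I : {set {set T}}) : bool :=
  [&& finset.set0 \in I,
      [forall X in I, X \subset E],
      [forall X in I, forall Y : {set T}, (Y \subset X) ==> (Y \in I)]
    & [forall X in I, forall Y in I, (#|X| < #|Y|)%N ==>
        [exists y in (Y :\: X)%SET, (y |: X)%SET \in I]]].

Record matroid (T : finType) (E : {set T}) := Matroid {
  indep : {set {set T}};
  indepP : matroid_axioms E indep }.

HB.instance Definition _ (T : finType) (E : {set T}) :=
  [isSub for @indep T E].
HB.instance Definition _ (T : finType) (E : {set T}) :=
  [Finite of matroid E by <:].

Definition is_direct_sum (T : finType) (E E1 E2 : {set T})
    (M : matroid E) (M1 : matroid E1) (M2 : matroid E2) : Prop :=
  [/\ [disjoint E1 & E2], E = (E1 :|: E2)%SET &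
      indep M = [set X1 :|: X2 | X1 in indep M1, X2 in indep M2]%SET].

Definition connected_matroid (T : finType) (E : {set T}) (M : matroid E) : Prop :=
  ~ exists (E1 E2 : {set T}) (M1 : matroid E1) (M2 : matroid E2),
      [/\ E1 != finset.set0, E2 != finset.set0 & is_direct_sum M M1 M2].

(** * Column matroids and positroids *)

(* [free] is about the sequence of columns: repeated columns are dependent. *)
Definition column_indep (F : fieldType) (d n : nat) (A : 'M[F]_(d, n)) :
    {set {set 'I_n}} :=
  [set X : {set 'I_n} | free [seq col i A | i in X]]%SET.

Lemma column_indep_matroid (F : fieldType) (d n : nat) (A : 'M[F]_(d, n)) :
  matroid_axioms [set: 'I_n]%SET (column_indep A).
Proof.
apply/and4P; split.
- by rewrite inE /image_mem enum_set0 nil_free.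
- by apply/'forall_implyP => X _; exact: finset.subsetT.
- apply/'forall_implyP => X; rewrite inE => fX; apply/'forall_implyP => Y YX.
  rewrite inE; suff : perm_eq (enum X) (enum Y ++ enum (X :\: Y)%SET).
    move=> /(perm_map (fun i => col i A)) /perm_free.
    by rewrite map_cat fX => /esym /catl_free.
  apply: uniq_perm; rewrite ?enum_uniq ?cat_uniq ?enum_uniq //=.
    rewrite andbT; apply/hasPn => i; rewrite !mem_enum !inE.
    by case/andP.
  move=> i; rewrite mem_cat !mem_enum !inE.
  by case: (boolP (i \in Y)) => //= /(fintype.subsetP YX) ->.
- apply/'forall_implyP => X; rewrite inE => fX; apply/'forall_implyP => Y.
  rewrite inE => fY; apply/implyP => XY; apply: contraT.
  rewrite negb_exists => /forallP noext.
  suff : (<<[seq col i A | i in Y]>> <= <<[seq col i A | i in X]>>)%VS.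
    move/dimvS; move: fX fY; rewrite /free => /eqP -> /eqP ->.
    by rewrite !size_image leqNgt XY.
  apply/span_subvP => v /mapP[i]; rewrite mem_enum => iY ->{v}.
  have [iX|iX] := boolP (i \in X); first by apply/memv_span/map_f; rewrite mem_enum.
  have := noext i; rewrite !inE iX iY /= => nf.
  apply: contraNT nf => vX.
  have /(perm_map (fun i => col i A)) /perm_free -> :
      perm_eq (enum (i |: X)%SET) (i :: enum X).
    apply: uniq_perm; rewrite /= ?enum_uniq ?mem_enum ?iX //.
    by move=> j; rewrite !inE !mem_enum !inE.
  by rewrite free_cons vX.
Qed.

Definition column_matroid (F : fieldType) (d n : nat) (A : 'M[F]_(d, n)) :
  matroid [set: 'I_n]%SET := Matroid (column_indep_matroid A).

(* The maximal minors are indexed by increasing maps ['I_d -> 'I_n]; [d = 0] is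
   allowed. *)
Definition positroid (R : realType) (n : nat) (M : matroid [set: 'I_n]%SET) : Prop :=
  exists (d : nat) (A : 'M[R]_(d, n)),
    [/\ \rank A = d,
        forall f : 'I_d -> 'I_n, {homo f : i j / (i < j)%N} ->
          0 <= \det (colsub f A)
      & M = column_matroid A].

Definition positroids (R : realType) (n : nat) : {set matroid [set: 'I_n]%SET} :=
  [set M | `[< positroid R M >]]%SET.

Definition connected_positroids (R : realType) (n : nat) :
    {set matroid [set: 'I_n]%SET} :=
  [set M in positroids R n | `[< connected_matroid M >]]%SET.

(* Main.v *)
(** A nonzero column [i] of a matrix is sent to the first [j] in the cyclic order
    [i + 1, i + 2, ..., i] such that column [i] lies in the span of the columns
    [i + 1, ..., j]; with the loops (zero columns) marked, this defines a decorated
    permutation [pi], which depends on the column matroid only.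

    For totally nonnegative matrices, the matroid and [pi] determine each other.
    If [pi] is not the identity, there are [i < j], with only fixed points in
    between, such that [j <= pi i] and [pi j <= i]. Adding a suitably signed
    multiple of column [i] to column [j] keeps a matrix totally nonnegative, turns
    [pi \o (i j)] into [pi], and adds to the bases exactly the sets [B - i + j] for
    bases [B]. Conversely, start from [pi] and subtract the largest multiple that
    keeps all minors nonnegative: the bases of the result are not closed under
    [B |-> B - i + j], so that its permutation can only be [pi \o (i j)]. The point
    is that the exchanges [a -> c] and [b -> e] in a basis cannot cross when the
    corresponding 2 x 2 matrix of coefficients is triangular, because total
    nonnegativity prescribes the signs of the coefficients.

    The same sign rule shows that a positroid is disconnected iff [pi] stabilizes a
    proper nonempty interval. Every decorated permutation has a unique noncrossing
    partition into stable blocks on which it stabilizes no proper relative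
    interval; this is the moment-cumulant relation between the numbers of
    positroids and of connected positroids. Finally there are
    [\sum_k n (n - 1) ... (n - k + 1)] decorated permutations, which is
    [E ((1 + Z) ^ n)]. *)

From mathcomp Require Import all_boot all_order all_algebra all_fingroup.
From mathcomp Require Import zify ring.
From mathcomp Require Import boolp reals.
Require Import Defs.

Set Implicit Arguments.
Unset Strict Implicit.
Unset Printing Implicit Defensive.

Import Order.TTheory GRing.Theory Num.Theory.

Local Open Scope ring_scope.

(** * Maximal minors and column exchanges *)

Section IncreasingEnumeration.
Variables (d n : nat).
Implicit Types (f g : 'I_d -> 'I_n) (B : {set 'I_n}).

Lemma enum_imset_incr f :
  {homo f : i j / (i < j)%N} -> enum (f @: setT) = [seq f k | k <- enum 'I_d].
Proof.
move=> fi.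
have so m : sorted (fun i j : 'I_m => (i < j)%N) (enum 'I_m).
  by have := iota_ltn_sorted 0 m; rewrite -val_enum_ord sorted_map.
have tr m : transitive (fun i j : 'I_m => (i < j)%N).
  by move=> ? ? ?; apply: ltn_trans.
apply: (irr_sorted_eq (leT := fun i j : 'I_n => (i < j)%N)) => //.
- exact: tr.
- by move=> i /=; rewrite ltnn.
- rewrite /enum_mem; apply: sorted_filter; first exact: tr.
  by rewrite -enumT; apply: so.
- by rewrite sorted_map; apply: sub_sorted (so d) => i j /=; apply: fi.
- move=> x; rewrite mem_enum; apply/imsetP/mapP => -[k _ ->]; exists k => //.
  by rewrite mem_enum.
Qed.

Lemma incr_inj f : {homo f : i j / (i < j)%N} -> injective f.
Proof.
move=> fi i j e; apply/val_inj; case: (ltngtP i j) => // /fi.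
  by rewrite e ltnn.
by rewrite e ltnn.
Qed.

Lemma incr_eq f g : {homo f : i j / (i < j)%N} -> {homo g : i j / (i < j)%N} ->
  f @: setT = g @: setT -> f =1 g.
Proof.
move=> fi gi e k; have := enum_imset_incr fi; rewrite e enum_imset_incr //.
by move/eq_in_map => -> //; rewrite mem_enum.
Qed.

(** Turns positions in an increasing enumeration into cardinalities, from which the sign of an
    exchange is read off. *)
Lemma incr_rank f (k : 'I_d) : {homo f : i j / (i < j)%N} ->
  #|[set y in f @: setT | (y < f k)%N]| = k.
Proof.
move=> fi; have -> : [set y in f @: setT | (y < f k)%N] =
    f @: [set l : 'I_d | (l < k)%N].
  apply/setP => y; rewrite !inE; apply/andP/imsetP => [[/imsetP[l _ ->]]|[l]].
    move=> lt; exists l => //; rewrite inE ltnNge; apply: contraL lt => kl.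
    rewrite -leqNgt; move: kl; rewrite leq_eqVlt => /predU1P[/val_inj ->|/fi/ltnW] //.
  by rewrite inE => /fi lk ->; rewrite imset_f.
rewrite card_imset; last exact: incr_inj.
rewrite cardsE cardE -(size_map val) -[RHS](size_iota 0); congr size.
rewrite /enum_mem -(filter_map val (fun l => l < k)%N) -enumT val_enum_ord.
apply: (irr_sorted_eq (leT := ltn)) => //.
- exact: ltn_trans.
- by move=> i /=; rewrite ltnn.
- apply: sorted_filter => //; [exact: ltn_trans|exact: iota_ltn_sorted].
- exact: iota_ltn_sorted.
- by move=> x; rewrite mem_filter !mem_iota /=; have := ltn_ord k; lia.
Qed.

Lemma incr_exists B : #|B| = d ->
  exists2 f : 'I_d -> 'I_n, {homo f : i j / (i < j)%N} & f @: setT = B.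
Proof.
move=> <-; exists (@enum_val _ (mem B)) => [i j ij|]; last first.
  apply/setP => x; apply/imsetP/idP => [[k _ ->]|xB]; first exact: enum_valP.
  by exists (enum_rank_in xB x); rewrite ?inE // enum_rankK_in.
have so : sorted (fun i j : 'I_n => (i < j)%N) (enum B).
  rewrite /enum_mem; apply: sorted_filter.
    by move=> ? ? ?; apply: ltn_trans.
  by rewrite -enumT; have := iota_ltn_sorted 0 n; rewrite -val_enum_ord sorted_map.
rewrite /enum_val !(set_nth_default (enum_default i)) -?cardE //.
apply: (sorted_ltn_nth _ _ so) => //; rewrite ?inE -?cardE //.
by move=> ? ? ?; apply: ltn_trans.
Qed.

End IncreasingEnumeration.

Definition between n (a c : 'I_n) : {set 'I_n} :=
  [set y : 'I_n | (a < y < c)%N || (c < y < a)%N].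

(** The matrix on the left is [colsub g A] with its columns permuted by [lift_perm k q 1], which
    sends [k] to [q] and keeps the other positions in order; its sign is [(-1) ^+ (k + q)]. *)
Lemma det_colsub_exchange (F : comPzRingType) d n (A : 'M[F]_(d, n))
    (f g : 'I_d -> 'I_n) (k q : 'I_d) :
    {homo f : i j / (i < j)%N} -> {homo g : i j / (i < j)%N} ->
    (f @: setT) :\ f k = (g @: setT) :\ g q ->
  \det (\matrix_(i, l) A i (if l == k then g q else f l)) =
  (-1) ^+ (k + q) * \det (colsub g A).
Proof.
case: d A f g k q => [|d] A f g k q fi gi fg; first by case: k {fg}.
have flg : f \o lift k =1 g \o lift q.
  apply: incr_eq.
  - by move=> i j ij; apply: fi; rewrite /= ltnNge leq_bump2 -ltnNge.
  - by move=> i j ij; apply: gi; rewrite /= ltnNge leq_bump2 -ltnNge.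
  have im (h : 'I_d.+1 -> 'I_n) x : {homo h : i j / (i < j)%N} ->
      (h \o lift x) @: setT = (h @: setT) :\ h x.
    move=> hi; apply/setP => y; rewrite !inE; apply/imsetP/andP.
      move=> [z _ ->]; rewrite (inj_eq (incr_inj hi)) eq_sym neq_lift; split=> //.
      exact: imset_f.
    move=> [yx /imsetP[z _ e]].
    have xz : x != z by apply: contraNneq yx => ->; rewrite e.
    by case: (unlift_some xz) => z' zz _; exists z'; rewrite // e zz.
  by rewrite !im.
have -> : (\matrix_(i, l) A i (if l == k then g q else f l)) =
    col_perm (lift_perm k q 1) (colsub g A).
  apply/matrixP => x l; rewrite !mxE.
  case: eqP => [->|/eqP lk]; first by rewrite lift_perm_id.
  rewrite eq_sym in lk; case: (unlift_some lk) => l' -> _.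
  by rewrite lift_perm_lift perm1; have /= <- := flg l'.
rewrite col_permE det_mulmx det_perm odd_permV odd_lift_perm odd_perm1 addbF.
by rewrite -oddD signr_odd mulrC.
Qed.

Section Minors.
Variables (F : fieldType) (d n : nat).
Implicit Types (A : 'M[F]_(d, n)) (B : {set 'I_n}) (v : 'cV[F]_d).

(* Meant for [#|B| = d]: missing columns are read as zero, surplus ones are
   ignored. *)
Definition minor A B : F :=
  \det (\matrix_(k < d, l < d) oapp (A k) 0 (onth (enum B) l)).

Lemma minor_incr A (f : 'I_d -> 'I_n) : {homo f : i j / (i < j)%N} ->
  minor A (f @: setT) = \det (colsub f A).
Proof.
move=> fi; congr (\det _); apply/matrixP => k l; rewrite !mxE enum_imset_incr //.
rewrite onth_map.
have -> : onth (enum 'I_d) l = Some l.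
  rewrite onthE (nth_map l) ?size_enum_ord //.
  by rewrite nth_ord_enum.
by [].
Qed.

Definition setcol A (a : 'I_n) v : 'M[F]_(d, n) :=
  \matrix_(i, j) if j == a then v i 0 else A i j.

Lemma minor_setcol_out A a v B : #|B| = d -> a \notin B ->
  minor (setcol A a v) B = minor A B.
Proof.
move=> /incr_exists[f fi <-] aB; rewrite !minor_incr //; congr (\det _).
apply/matrixP => k l; rewrite !mxE; case: eqP => // e.
by rewrite -e imset_f in aB.
Qed.

Lemma minor_setcolD A a u v B (b c : F) : #|B| = d -> a \in B ->
  minor (setcol A a (b *: u + c *: v)) B =
  b * minor (setcol A a u) B + c * minor (setcol A a v) B.
Proof.
move=> /incr_exists[f fi <-] /imsetP[k _ ->]; rewrite !minor_incr //.
rewrite -!(det_tr (colsub _ _)).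
apply: (@determinant_multilinear _ _ _ _ _ k).
- by apply/rowP => l; rewrite !mxE eqxx.
- by apply/matrixP => x l; rewrite !mxE (inj_eq (incr_inj fi)) eq_sym (negbTE (neq_lift _ _)).
- by apply/matrixP => x l; rewrite !mxE (inj_eq (incr_inj fi)) eq_sym (negbTE (neq_lift _ _)).
Qed.

Lemma minor_setcol_sum A a B (I : finType) (P : pred I) (la : I -> F)
    (v : I -> 'cV[F]_d) : #|B| = d -> a \in B ->
  minor (setcol A a (\sum_(x | P x) la x *: v x)) B =
  \sum_(x | P x) la x * minor (setcol A a (v x)) B.
Proof.
move=> cB aB.
apply: (big_ind2 (fun u m => minor (setcol A a u) B = m)) => //.
- have := minor_setcolD A 0 0 0 0 cB aB.
  by rewrite !scale0r !mul0r !addr0.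
- move=> u1 m1 u2 m2 <- <-.
  by have := minor_setcolD A u1 u2 1 1 cB aB; rewrite !scale1r !mul1r.
- move=> x _; have := minor_setcolD A (v x) 0 (la x) 0 cB aB.
  by rewrite !scale0r !mul0r !addr0.
Qed.

Lemma setcol_id A a : setcol A a (col a A) = A.
Proof. by apply/matrixP => i j; rewrite !mxE; case: eqP => // ->. Qed.

Lemma minor_setcol_dup A a c B : #|B| = d -> a \in B -> c \in B -> c != a ->
  minor (setcol A a (col c A)) B = 0.
Proof.
move=> /incr_exists[f fi <-] /imsetP[k _ ->] /imsetP[l _ ->] lk.
rewrite minor_incr // -det_tr.
have kl : k != l by apply: contraNneq lk => ->.
apply: (determinant_alternate kl) => x; rewrite !mxE eqxx.
by rewrite (negbTE lk).
Qed.

Lemma card_exchange B (a c : 'I_n) : a \in B -> c \notin B ->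
  #|c |: B :\ a| = #|B|.
Proof.
move=> aB cB; rewrite cardsU1 !inE (negbTE cB) andbF /= (cardsD1 a B) aB.
by [].
Qed.

(* Sorting the columns of [B - a + c] moves one column across those lying
   between [a] and [c]. *)
Lemma minor_setcol_exchange A a c B : #|B| = d -> a \in B -> c \notin B ->
  minor (setcol A a (col c A)) B =
  (-1) ^+ #|B :&: between a c| * minor A (c |: B :\ a).
Proof.
move=> cB aB ncB.
have cB' : #|c |: B :\ a| = d by rewrite card_exchange.
have [f fi fB] := incr_exists cB; have [g gi gB] := incr_exists cB'.
move: (aB); rewrite -{1}fB => /imsetP[k _ ak].
have : c \in g @: setT by rewrite gB !inE eqxx.
move=> /imsetP[q _ cq].
have kE := incr_rank k fi; have qE := incr_rank q gi.
rewrite fB -ak in kE; rewrite gB -cq in qE.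
(* [k] and [q] are the ranks of [a] in [B] and of [c] in the exchanged set, so they differ by the
   number of elements of [B] in between. *)
have par : odd (k + q) = odd #|B :&: between a c|.
  have aneqc : a != c by apply: contraNneq ncB => <-.
  have [ac|ca] : (a < c)%N \/ (c < a)%N.
    by move: aneqc; rewrite -val_eqE /=; case: ltngtP; auto.
- have : (q : nat) = (k + #|B :&: between a c|)%N.
      rewrite -qE -kE -cardsUI.
      have -> : [set y in B | (y < a)%N] :&: (B :&: between a c) = set0.
        by apply/setP => y; rewrite !inE; lia.
      rewrite cards0 addn0; apply: eq_card => y; rewrite !inE -!val_eqE /=.
      by case: (boolP (y \in B)) => /= yB; lia.
    by lia.
- have : (k : nat) = (q + #|B :&: between a c|)%N.
      rewrite -qE -kE -cardsUI.
      have -> : [set y in c |: B :\ a | (y < c)%N] :&: (B :&: between a c) = set0.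
        by apply/setP => y; rewrite !inE -!val_eqE /=; lia.
      rewrite cards0 addn0; apply: eq_card => y; rewrite !inE -!val_eqE /=.
      have : (y \in B) -> (y : nat) <> c by move=> yB yc; move: ncB; rewrite -(val_inj yc) yB.
      by case: (boolP (y \in B)) => /= yB; lia.
    by lia.
rewrite -{1}fB -gB !minor_incr // -signr_odd -par signr_odd.
have := @det_colsub_exchange _ _ _ A f g k q fi gi; rewrite -ak -cq fB gB => <-.
  congr (\det _); apply/matrixP => x l; rewrite !mxE ak (inj_eq (incr_inj fi)).
  by case: eqP.
apply/setP => y; rewrite !inE.
have : (y \in B) -> y != c by move=> yB; apply: contraNneq ncB => <-.
by case: (y \in B); case: (y == c); rewrite /= ?andbF ?orbT ?orbF ?andbT //; move/(_ isT).
Qed.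

(** Cramer's rule: in the expansion of column [c] only the term of [a] survives, every other one
    repeating a column of [B]. *)
Lemma minor_exchange A B a c (la : 'I_n -> F) : #|B| = d -> a \in B -> c \notin B ->
  col c A = \sum_(x in B) la x *: col x A ->
  minor A (c |: B :\ a) = (-1) ^+ #|B :&: between a c| * la a * minor A B.
Proof.
move=> cB aB ncB e; have := minor_setcol_exchange A cB aB ncB.
rewrite {1}e (minor_setcol_sum _ _ _ _ cB aB) (bigD1 a) //= setcol_id.
rewrite big1 => [|x /andP[xB xa]]; last by rewrite minor_setcol_dup ?mulr0.
rewrite addr0 -mulrA => ->; rewrite mulrA -exprD addnn -mul2n exprM sqrrN.
by rewrite !expr1n mul1r.
Qed.

End Minors.

(** * Column spans *)

Section ColumnSpan.
Variables (F : fieldType) (d n : nat).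
Implicit Types (A : 'M[F]_(d, n)) (X Y B : {set 'I_n}) (v : 'cV[F]_d).

Definition colspan A X : {vspace 'cV[F]_d} := <<[seq col i A | i in X]>>%VS.
Definition colindep A X : bool := free [seq col i A | i in X].

Lemma mem_colspan A X i : i \in X -> col i A \in colspan A X.
Proof. by move=> iX; apply/memv_span/map_f; rewrite mem_enum. Qed.

Lemma colspan_subvP A X (V : {vspace 'cV[F]_d}) :
  reflect {in X, forall i, col i A \in V} (colspan A X <= V)%VS.
Proof.
apply: (iffP span_subvP) => [H i iX|H v /mapP[i]].
  by apply/H/map_f; rewrite mem_enum.
by rewrite mem_enum => iX ->; apply: H.
Qed.

Lemma colspanS A X Y : X \subset Y -> (colspan A X <= colspan A Y)%VS.
Proof. by move=> /subsetP XY; apply/colspan_subvP => i /XY; apply: mem_colspan. Qed.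

Lemma mem_colspanS A X Y v : X \subset Y -> v \in colspan A X -> v \in colspan A Y.
Proof. by move=> /(colspanS A) /subvP; apply. Qed.

Lemma colspanU A X Y : colspan A (X :|: Y) = (colspan A X + colspan A Y)%VS.
Proof.
apply/eqP; rewrite eqEsubv subv_add !colspanS ?subsetUl ?subsetUr // !andbT.
apply/colspan_subvP => i; rewrite inE => /orP[] /(mem_colspan A) H.
  by rewrite (subvP (addvSl _ _)).
by rewrite (subvP (addvSr _ _)).
Qed.

Lemma colspan1 A i : colspan A [set i] = <[col i A]>%VS.
Proof. by rewrite /colspan /image_mem enum_set1 span_seq1. Qed.

Lemma colspanE A X : colspan A X = (\sum_(i in X) <[col i A]>)%VS.
Proof. by rewrite /colspan span_def big_map big_enum. Qed.

Lemma colspanP A X v :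
  reflect (exists la : 'I_n -> F, v = \sum_(i in X) la i *: col i A)
          (v \in colspan A X).
Proof.
apply: (iffP idP) => [|[la ->]].
  rewrite colspanE => /memv_sumP[u uP ->].
  have [la laP] : exists la : 'I_n -> F, forall i, i \in X -> u i = la i *: col i A.
    apply: (@fin_all_exists _ _ (fun i c => i \in X -> u i = c *: col i A)) => i.
    by case: (boolP (i \in X)) => [/uP/vlineP[c ->]|_]; [exists c|exists 0].
  by exists la; apply: eq_bigr.
by apply: memv_suml => i iX; rewrite memvZ // mem_colspan.
Qed.

Lemma eq_colindep A X (s : seq 'I_n) : uniq s -> X =i s ->
  colindep A X = free [seq col i A | i <- s].
Proof.
move=> us e; apply/perm_free/perm_map/uniq_perm; rewrite ?enum_uniq // => i.
by rewrite mem_enum.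
Qed.

Lemma colindepU1 A X i : i \notin X ->
  colindep A (i |: X) = (col i A \notin colspan A X) && colindep A X.
Proof.
move=> iX; rewrite (@eq_colindep A _ (i :: enum X)) /= ?mem_enum ?iX ?enum_uniq //.
  by rewrite free_cons.
by move=> j; rewrite !inE mem_enum.
Qed.

Lemma colindep0 A : colindep A set0.
Proof. by rewrite /colindep /image_mem enum_set0 nil_free. Qed.

Lemma colindep_dim A X : colindep A X = (\dim (colspan A X) == #|X|).
Proof. by rewrite /colindep /free size_image. Qed.

Lemma colindepS A X Y : X \subset Y -> colindep A Y -> colindep A X.
Proof.
move=> XY; rewrite (@eq_colindep A Y (enum X ++ enum (Y :\: X))); first 1 last.
- rewrite cat_uniq !enum_uniq andbT /=; apply/hasPn => i.
  by rewrite !mem_enum !inE => /andP[].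
- move=> i; rewrite mem_cat !mem_enum !inE.
  by case: (boolP (i \in X)) => //= /(subsetP XY).
by rewrite map_cat => /catl_free.
Qed.

Lemma colindepD1 A X i : colindep A X -> i \in X -> col i A \notin colspan A (X :\ i).
Proof. by move=> + iX; rewrite -{1}(setD1K iX) colindepU1 ?setD11 // => /andP[]. Qed.

(** A maximal independent set between [Y] and [X] spans the columns of [X], since a column outside
    its span could be added. *)
Lemma colindep_ext A X Y : Y \subset X -> colindep A Y ->
  exists Z : {set 'I_n},
    [/\ Y \subset Z, Z \subset X, colindep A Z & colspan A Z = colspan A X].
Proof.
move=> YX iY; pose p (Z : {set 'I_n}) := [&& Y \subset Z, Z \subset X & colindep A Z].
have pY : p Y by rewrite /p subxx YX.
have [Z /maxsetP[/and3P[YZ ZX iZ] maxZ] _] := maxset_exists pY.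
exists Z; split => //; apply/eqP; rewrite eqEsubv colspanS //=.
apply/colspan_subvP => i iX; apply: contraT => niZ.
have inZ : i \notin Z by apply: contra niZ => /(mem_colspan A).
suff /maxZ : p (i |: Z).
  by rewrite subsetUr => /(_ isT) e; rewrite -e setU11 in inZ.
rewrite /p subUset sub1set iX ZX colindepU1 // niZ iZ (subset_trans YZ) //.
exact: subsetUr.
Qed.

Lemma memv_add_line (V : {vspace 'cV[F]_d}) u v :
  u \in (<[v]> + V)%VS -> u \notin V -> v \in (<[u]> + V)%VS.
Proof.
move=> /memv_addP[w /vlineP[c ->] [z zV e]] nu.
have c0 : c != 0 by apply: contraNneq nu => c0; rewrite e c0 scale0r add0r.
apply/memv_addP; exists (c^-1 *: u); first by rewrite memvZ ?memv_line.
exists (- (c^-1 *: z)); first by rewrite memvN memvZ.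
by rewrite e scalerDr scalerA mulVf // scale1r addrK.
Qed.

Lemma colspan_exchange A X i j : col i A \in colspan A (j |: X) ->
  col i A \notin colspan A X -> col j A \in colspan A (i |: X).
Proof. by rewrite !colspanU !colspan1; apply: memv_add_line. Qed.

Lemma colspan_setU1_id A X i : col i A \in colspan A X ->
  colspan A (i |: X) = colspan A X.
Proof.
move=> iX; rewrite colspanU colspan1; apply/addv_idPr.
by apply/subvP => v /vlineP[c ->]; rewrite memvZ.
Qed.

(** Membership in a span is expressed through independent sets alone; hence [decperm] depends only
    on the column matroid. *)
Lemma mem_colspan_colindep A X i :
  (col i A \in colspan A X) =
  (i \in X) || [exists Y : {set 'I_n},
    [&& Y \subset X, colindep A Y & ~~ colindep A (i |: Y)]].
Proof.
apply/idP/orP => [iX|[|/existsP[Y /and3P[YX iY]]]]; last 2 first.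
- exact: mem_colspan.
- case: (boolP (i \in Y)) => [iY'|niY].
    by rewrite (setUidPr _) ?sub1set // iY.
  by rewrite colindepU1 // iY andbT negbK => /(mem_colspanS YX).
have [iX'|niX] := boolP (i \in X); [by left|right].
have [Y [_ YX iY sY]] := colindep_ext (sub0set X) (colindep0 A).
apply/existsP; exists Y; rewrite YX iY colindepU1 ?sY ?iX //.
by apply: contra niX => /(subsetP YX).
Qed.

Lemma minor_neq0 A B : #|B| = d -> (minor A B != 0) = colindep A B.
Proof.
move=> cB; apply/idP/idP => [m0|]; last first.
  apply: contraTneq => m0; have [f fi fB] := incr_exists cB.
  move: m0; rewrite -{1}fB minor_incr // -det_tr => /eqP/det0P[v /rV0Pn[k vk] ve].
  have {ve} ve : \sum_l v 0 l *: col (f l) A = 0.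
    apply/colP => x; rewrite summxE !mxE; move/rowP/(_ x): ve.
    by rewrite !mxE => ve; rewrite -[RHS]ve; apply: eq_bigr => l _; rewrite !mxE.
  have fkB : f k \in B by rewrite -fB imset_f.
  apply/negP => iB; have := colindepD1 iB fkB; apply/negP/negPn.
  move/eqP: ve; rewrite (bigD1 k) //= addr_eq0 => /eqP/(congr1 (fun w => (v 0 k)^-1 *: w)).
  rewrite scalerA mulVf // scale1r => ->; rewrite memvZ // memvN memv_suml // => l lk.
  by rewrite memvZ // mem_colspan // !inE (inj_eq (incr_inj fi)) lk -fB imset_f.
apply: contraNT m0 => niB; apply/eqP.
have [Y [_ YB iY sY]] := colindep_ext (sub0set B) (colindep0 A).
have /subsetPn[x xB xY] : ~~ (B \subset Y).
  by apply: contra niB => BY; apply: colindepS BY iY.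
have /colspanP[la e] : col x A \in colspan A (B :\ x).
  rewrite (mem_colspanS _ (X := Y)) ?sY ?mem_colspan //.
  by apply/subsetP => y yY; rewrite !inE (subsetP YB) // andbT; apply: contraNneq xY => <-.
rewrite -[A in minor A](setcol_id A x) e minor_setcol_sum // big1 // => y.
by rewrite !inE => /andP[yx yB]; rewrite minor_setcol_dup ?mulr0.
Qed.

Lemma colspan_setT A : \rank A = d <-> colspan A setT = fullv.
Proof.
split=> [rA|].
  apply/eqP; rewrite eqEsubv subvf /=; apply/subvP => v _.
  apply/colspanP; exists (fun i => (pinvmx A *m v) i 0).
  have rf : row_free A by rewrite /row_free rA.
  rewrite -{1}[v]mul1mx -(mulmxVp rf) -mulmxA.
  apply/colP => x; rewrite summxE !mxE; apply: eq_big => [i|i _]; rewrite ?inE //.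
  by rewrite !mxE mulrC.
move=> fA; have [B [_ _ iB sB]] := colindep_ext (sub0set setT) (colindep0 A).
have cB : #|B| = d.
  move: iB; rewrite colindep_dim sB fA dimvf /= => /eqP <-.
  by rewrite /dim /= muln1.
have := minor_neq0 A cB; rewrite iB; have [f fi <-] := incr_exists cB.
rewrite minor_incr // -unitfE -[_ \is a _]/(colsub f A \in unitmx).
move=> /mxrank_unit r; apply/eqP; rewrite eqn_leq rank_leq_row /= -{1}r.
have -> : colsub f A = A *m colsub f 1%:M by rewrite mulmx_colsub mulmx1.
exact: mxrankM_maxl.
Qed.

Lemma colindep_card_full A B : colspan A setT = fullv -> colindep A B ->
  (colspan A B == fullv) = (#|B| == d).
Proof.
move=> fA; rewrite colindep_dim => /eqP <-.
have dimF : \dim {:'cV[F]_d} = d by rewrite dimvf /dim /= muln1.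
by rewrite eqEdim subvf dimF eqn_leq -[X in _ = (_ <= X)%N && _]dimF dimvS ?subvf.
Qed.

(** Independent sets are the subsets of bases, so the nonvanishing maximal minors determine the
    matroid. *)
Lemma colindep_basis A X : colspan A setT = fullv ->
  colindep A X = [exists B : {set 'I_n}, [&& X \subset B, #|B| == d & minor A B != 0]].
Proof.
move=> fA; apply/idP/existsP => [iX|[B /and3P[XB /eqP cB]]]; last first.
  by rewrite minor_neq0 //; apply: colindepS.
have [B [XB _ iB sB]] := colindep_ext (subsetT X) iX.
have cB : #|B| = d by apply/eqP; rewrite -(colindep_card_full fA iB) sB fA.
by exists B; rewrite XB cB eqxx minor_neq0.
Qed.

End ColumnSpan.

(** * Cyclic intervals *)

Section CyclicOrder.
Variable n : nat.
Implicit Types i j k x y : 'I_n.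

(* Rank of [x] in the cyclic order [i + 1, i + 2, ..., i]. *)
Definition cyc i x : nat := if (i < x)%N then (x - i).-1 else (x + n - i).-1.

(* The elements strictly between [i] and [j] in cyclic order; all elements
   other than [i] when [i = j]. *)
Definition arc i j : {set 'I_n} := [set x | (cyc i x < cyc i j)%N].

Lemma cycP i x :
  (i < x /\ cyc i x + i + 1 = x)%N \/ (x <= i /\ cyc i x + i + 1 = x + n)%N.
Proof. by rewrite /cyc; have := ltn_ord i; case: (ltnP i x) => ? ?; [left|right]; lia. Qed.

Lemma cyc_inj i : injective (cyc i).
Proof.
move=> x y e; apply: val_inj => /=.
move: (ltn_ord x) (ltn_ord y) (cycP i x) (cycP i y); lia.
Qed.

Lemma cyc_surj i (k : nat) : (k < n)%N -> exists x, cyc i x = k.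
Proof.
move=> kn; have := ltn_ord i => iN.
have [lt|ge] := ltnP (i + k + 1) n.
  by exists (Ordinal lt); have := cycP i (Ordinal lt); rewrite /=; lia.
have lt : (i + k + 1 - n < n)%N by lia.
by exists (Ordinal lt); have := cycP i (Ordinal lt); rewrite /=; lia.
Qed.

Lemma arcii i : arc i i = ~: [set i].
Proof.
apply/setP => x; rewrite !inE -val_eqE /=.
by move: (ltn_ord i) (ltn_ord x) (cycP i x) (cycP i i); lia.
Qed.

Lemma arcU1 i j : j |: arc i j = [set x | (cyc i x <= cyc i j)%N].
Proof. by apply/setP => x; rewrite !inE [in RHS]leq_eqVlt (inj_eq (@cyc_inj i)). Qed.

(** Going round from [k], either [i] comes before [j], and the arc from [i] lies inside the one from
    [k], or it does not, and the inclusion is reversed. *)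
Lemma arc_nested i k j : i != k ->
  (k |: arc k j \subset arc i j) || (i |: arc i j \subset arc k j).
Proof.
move=> ik; have [lt|ge] := ltnP (cyc k i) (cyc k j).
  apply/orP; right; apply/subsetP => x; rewrite !inE -!val_eqE /=.
  move: (ltn_ord i) (ltn_ord x) (ltn_ord k) (ltn_ord j).
  move: (cycP k i) (cycP k j) (cycP i x) (cycP i j) (cycP k x).
  by move: ik lt; rewrite -val_eqE /=; lia.
apply/orP; left; apply/subsetP => x; rewrite !inE -!val_eqE /=.
move: (ltn_ord i) (ltn_ord x) (ltn_ord k) (ltn_ord j).
move: (cycP k i) (cycP k j) (cycP i x) (cycP i j) (cycP k x).
by move: ik ge; rewrite -val_eqE /=; lia.
Qed.

End CyclicOrder.

(** * Decorated permutations *)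

(* A decorated permutation, as the partial map sending a loop to [None]. *)
Definition decperms n : {set {ffun 'I_n -> option 'I_n}} :=
  [set h : {ffun 'I_n -> option 'I_n} | injectiveb (fun x => odflt x (h x))].

Definition fixes_between n (h : {ffun 'I_n -> option 'I_n}) (i j : 'I_n) :=
  forall y : 'I_n, (i < y < j)%N -> odflt y (h y) = y.

Section DecoratedPermutation.
Variables (F : fieldType) (n d : nat).
Implicit Types (A : 'M[F]_(d, n)) (X Y B : {set 'I_n}).

Definition link A i j : bool :=
  (col i A \in colspan A (j |: arc i j)) && (col i A \notin colspan A (arc i j)).

Definition decperm A : {ffun 'I_n -> option 'I_n} := [ffun i => [pick j | link A i j]].

Lemma link_uniq A i j k : link A i j -> link A i k -> j = k.
Proof.
have aux j' k' : link A i j' -> link A i k' -> (cyc i k' <= cyc i j')%N.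
  move=> /andP[ij _] /andP[_ ik]; rewrite leqNgt; apply: contra ik => jk.
  rewrite (mem_colspanS _ ij) // arcU1; apply/subsetP => x; rewrite !inE => xj.
  exact: leq_ltn_trans jk.
by move=> ij ik; apply/(@cyc_inj _ i)/eqP; rewrite eqn_leq !aux.
Qed.

(** If [i] and [k] differ, one arc contains the other together with its starting point. By exchange,
    column [j] lies in the span of the smaller arc with its start, so adding [j] to the larger arc
    does not enlarge its span. *)
Lemma link_inj A i j k : link A i j -> link A k j -> i = k.
Proof.
move=> /andP[ij nij] /andP[kj nkj]; apply/eqP; apply: contraT => ik.
have aux x y : col x A \in colspan A (j |: arc x j) -> col x A \notin colspan A (arc x j) ->
    col y A \notin colspan A (arc y j) -> col y A \in colspan A (j |: arc y j) ->
    x |: arc x j \subset arc y j -> False.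
  move=> xj nxj nyj yj sub; have jx := colspan_exchange xj nxj.
  move: nyj; rewrite -(colspan_setU1_id (mem_colspanS sub jx)) => /negP; apply.
  exact: yj.
by case/orP: (arc_nested j ik) => sub; exfalso; [apply: (aux k i)|apply: (aux i k)].
Qed.

Lemma link_neq0 A i j : link A i j -> (col i A != 0) && (col j A != 0).
Proof.
move=> /andP[ij nij]; apply/andP; split; apply: contraNneq nij => e; rewrite ?e ?mem0v //.
by rewrite -(@colspan_setU1_id _ _ _ _ _ j) // e mem0v.
Qed.

Lemma link_exists A i : col i A != 0 -> exists j, link A i j.
Proof.
move=> i0; have exk : exists k : nat, col i A \in colspan A [set x | (cyc i x < k)%N].
  exists n; apply: mem_colspan; rewrite inE.
  by move: (cycP i i) (ltn_ord i); lia.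
have [[|k] kP kmin] := ex_minnP exk.
  move: kP; rewrite (_ : [set _ | _] = set0); last by apply/setP => x; rewrite !inE.
  by rewrite colspanE big_set0 memv0 (negbTE i0).
have kn : (k < n)%N.
  apply: kmin; apply: mem_colspan; rewrite inE.
  by move: (cycP i i) (ltn_ord i); lia.
have [j jk] := cyc_surj i kn; exists j.
rewrite /link arcU1 jk (_ : [set _ | _] = [set x | (cyc i x < k.+1)%N]) //.
rewrite kP /= /arc jk; apply/negP => /kmin; rewrite ltnn.
by [].
Qed.

Lemma decpermP A i j : reflect (decperm A i = Some j) (link A i j).
Proof.
rewrite ffunE; case: pickP => [k ik|none]; last by rewrite none; constructor.
by apply: (iffP idP) => [/(link_uniq ik) ->|[<-]].
Qed.

Lemma decperm_None A i : (decperm A i == None) = (col i A == 0).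
Proof.
rewrite ffunE; case: pickP => [k /link_neq0/andP[/negbTE -> _]//|none].
rewrite eqxx; apply/esym; apply: contraT => /link_exists[j].
by rewrite none.
Qed.

Lemma decpermPn A i : reflect (decperm A i = None) (col i A == 0).
Proof. by rewrite -decperm_None; apply: eqP. Qed.

Lemma decperm_decperms A : decperm A \in decperms n.
Proof.
rewrite inE; apply/injectiveP => i k /=.
case ei: (decperm A i) => [j|]; case ek: (decperm A k) => [l|] //= e.
- by move: ei ek; rewrite e => /decpermP + /decpermP; apply: link_inj.
- by move/decpermP/link_neq0: ei => /andP[_]; rewrite e -decperm_None ek.
- by move/decpermP/link_neq0: ek => /andP[_]; rewrite -e -decperm_None ei.
Qed.

Lemma decperm_coloop A i :
  (decperm A i == Some i) = (col i A \notin colspan A (~: [set i])).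
Proof.
apply/eqP/idP => [/decpermP/andP[]|ni]; first by rewrite arcii.
apply/decpermP; rewrite /link arcii ni andbT; apply: mem_colspan.
exact: setU11.
Qed.

(** The cyclic interval from [i + 1] to [j] stays above [i] iff [i < j]. This turns the inequalities
    of [bridgeable] into span conditions on final segments. *)
Lemma decperm_gt A i j : decperm A i = Some j ->
  (i < j)%N = (col i A \in colspan A [set x : 'I_n | (i < x)%N]).
Proof.
move=> /decpermP/andP[ij nij]; apply/idP/idP => [lt|gt].
  rewrite (mem_colspanS _ ij) // arcU1; apply/subsetP => x; rewrite !inE.
  by move: (ltn_ord i) (ltn_ord x) (ltn_ord j) (cycP i x) (cycP i j); lia.
rewrite ltnNge; apply: contra nij => ji; rewrite (mem_colspanS _ gt) //.
apply/subsetP => x; rewrite !inE.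
by move: (ltn_ord i) (ltn_ord x) (ltn_ord j) (cycP i x) (cycP i j); lia.
Qed.

End DecoratedPermutation.

Lemma eq_decperm (F : fieldType) n d1 d2 (A1 : 'M[F]_(d1, n)) (A2 : 'M[F]_(d2, n)) :
  colindep A1 =1 colindep A2 -> decperm A1 = decperm A2.
Proof.
move=> e; apply/ffunP => i; rewrite !ffunE; apply: eq_pick => j.
have e' X : (col i A1 \in colspan A1 X) = (col i A2 \in colspan A2 X).
  rewrite !mem_colspan_colindep; congr orb; apply: eq_existsb => Y.
  by rewrite !e.
by rewrite /link !e'.
Qed.

(** * Column operations and their effect on decorated permutations *)

Section AddColumn.
Variables (F : fieldType) (n d : nat).
Implicit Types (A : 'M[F]_(d, n)) (X Y B : {set 'I_n}) (i j : 'I_n) (t : F).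

Definition addcol A i j t := setcol A j (col j A + t *: col i A).

Lemma col_addcol A i j t x :
  col x (addcol A i j t) = if x == j then col j A + t *: col i A else col x A.
Proof. by apply/colP => k; rewrite !mxE; case: eqP => // _; rewrite !mxE. Qed.

Lemma addcolK A i j t : i != j -> addcol (addcol A i j t) i j (- t) = A.
Proof.
move=> ij; apply/matrixP => k x; rewrite !mxE !eqxx (negbTE ij).
by case: eqP => [->|//]; ring.
Qed.

Lemma colspan_addcol A i j t X : i != j -> (j \in X -> i \in X) ->
  colspan (addcol A i j t) X = colspan A X.
Proof.
move=> ij jiX.
have le (A' : 'M[F]_(d, n)) s : (colspan (addcol A' i j s) X <= colspan A' X)%VS.
  apply/colspan_subvP => x xX; rewrite col_addcol.
  case: eqP => [xj|_]; last exact: mem_colspan.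
  by rewrite xj in xX; rewrite memvD ?memvZ ?mem_colspan ?jiX.
by apply/eqP; rewrite eqEsubv le -{1}(addcolK A t ij) le.
Qed.

(** For [x] outside the interval from [i] to [j], the cyclic order starting after [x] meets [i]
    before [j], so the operation preserves the spans that matter. Inside, [x] is a loop or a coloop
    and remains one. *)
Lemma decperm_addcol A i j t x : (i < j)%N -> x != i -> x != j ->
  fixes_between (decperm A) i j ->
  decperm (addcol A i j t) x = decperm A x.
Proof.
move=> ij xi xj fixed; have ij' : i != j by rewrite -val_eqE /= neq_ltn ij.
have cx : col x (addcol A i j t) = col x A by rewrite col_addcol (negbTE xj).
have [xij|nxij] := boolP (i < x < j)%N.
  have := fixed _ xij; case ex: (decperm A x) => [y|] /= e.
    move: ex; rewrite e => /eqP; rewrite decperm_coloop => nc; apply/eqP.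
    by rewrite decperm_coloop cx colspan_addcol // !inE !(eq_sym _ x) xi.
  by apply/decpermPn; rewrite cx; apply/decpermPn.
rewrite !ffunE; apply: eq_pick => y; rewrite /link cx.
suff ar : [/\ i \in arc x j & (j \in arc x y -> i \in arc x y)].
  rewrite !colspan_addcol //; first by case: ar.
  rewrite !inE; case: (eqVneq j y) ar => [<- [ar _] _|_ [_ /=]].
    by move: ar; rewrite inE orbC => ->.
  by rewrite !inE => ar /ar ->; rewrite orbT.
move: xi xj nxij; rewrite !inE -!val_eqE /=.
move: (ltn_ord i) (ltn_ord x) (ltn_ord y) (ltn_ord j) (cycP x i) (cycP x j) (cycP x y); lia.
Qed.

Lemma minor_addcol A i j t B : i != j -> #|B| = d ->
  minor (addcol A i j t) B = minor A B +
    if (j \in B) && (i \notin B) then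
      t * ((-1) ^+ #|B :&: between j i| * minor A (i |: B :\ j)) else 0.
Proof.
move=> ij cB; case: (boolP (j \in B)) => [jB|njB] /=; last first.
  by rewrite addr0 /addcol minor_setcol_out.
have := minor_setcolD A (col j A) (col i A) 1 t cB jB.
rewrite /addcol scale1r setcol_id mul1r => ->; congr (_ + _).
case: (boolP (i \in B)) => [iB|niB] /=; last by rewrite minor_setcol_exchange.
by rewrite minor_setcol_dup ?mulr0.
Qed.

End AddColumn.

(** * Totally nonnegative matrices and bridges *)

Section TotallyNonnegative.
Variables (R : realFieldType) (d n : nat).
Implicit Types (A : 'M[R]_(d, n)) (X Y B K : {set 'I_n}) (i j a b c e : 'I_n).

Definition tnn A := forall B, #|B| = d -> 0 <= minor A B.

(** By Cramer's rule the signed coefficient is a ratio of two maximal minors, both positive here. *)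
Lemma tnn_coef_sign A B a c (la : 'I_n -> R) : tnn A -> #|B| = d -> minor A B != 0 ->
  a \in B -> c \notin B -> col c A = \sum_(x in B) la x *: col x A -> la a != 0 ->
  minor A (c |: B :\ a) != 0 /\ 0 < (-1) ^+ #|B :&: between a c| * la a.
Proof.
move=> tA cB mB aB cB' ce la0; have := minor_exchange cB aB cB' ce.
have mB0 : 0 < minor A B by rewrite lt_def mB tA.
move=> e; have nz : minor A (c |: B :\ a) != 0.
  by rewrite e !mulf_neq0 // signr_eq0.
split=> //; have : 0 < minor A (c |: B :\ a).
  by rewrite lt_def nz tA // card_exchange.
by rewrite e pmulr_lgt0.
Qed.

Lemma sum_supp_setU1_D1 B a b (la : 'I_n -> R) (v : 'I_n -> 'cV[R]_d) :
  a \in B -> b \notin B -> la a = 0 ->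
  \sum_(x in B) la x *: v x =
  \sum_(x in b |: B :\ a) (if x == b then 0 else la x) *: v x.
Proof.
move=> aB nbB la0; rewrite (bigD1 a) //= la0 scale0r add0r.
rewrite [RHS](bigD1 b) ?setU11 //= eqxx scale0r add0r.
apply: eq_big => [x|x /andP[xB xa]].
  rewrite !inE; case: (eqVneq x b) => [->|]; rewrite ?(negbTE nbB) ?andbF //=.
  by rewrite andbT andbC.
by case: eqP => // xb; rewrite -xb xB in nbB.
Qed.

Lemma card_exchangeI B X b e : b \in B -> e \notin B ->
  (#|(e |: B :\ b) :&: X| + (b \in X) = #|B :&: X| + (e \in X))%N.
Proof.
move=> bB eB; rewrite (cardsD1 e) (cardsD1 b (B :&: X)) !inE eqxx bB /=.
have -> : ((e |: B :\ b) :&: X) :\ e = (B :&: X) :\ b.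
  apply/setP => x; rewrite !inE.
  case: (eqVneq x e) => [->|_] /=; first by rewrite (negbTE eB) andbF.
  by rewrite andbA.
by rewrite addnAC [in RHS]addnAC; congr addn; rewrite addnC.
Qed.

(* The two exchanges [a -> c] and [b -> e] in the basis [B] cannot cross: the
   coefficient of [a] in column [c] is the same for the bases [B] and
   [B - b + e], while the sign that total nonnegativity prescribes for it
   depends on the number of basis elements between [a] and [c]. *)
Lemma tnn_noncrossing A B a b c e (la mu : 'I_n -> R) : tnn A ->
  #|B| = d -> minor A B != 0 -> a \in B -> b \in B -> a != b ->
  c \notin B -> e \notin B -> c != e ->
  col c A = \sum_(x in B) la x *: col x A -> la a != 0 -> la b = 0 ->
  col e A = \sum_(x in B) mu x *: col x A -> mu b != 0 ->
  (b \in between a c) = (e \in between a c).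
Proof.
move=> tA cB mB aB bB ab cB' eB' ce cA la0 lb0 eA mb0.
have [mB' _] := tnn_coef_sign tA cB mB bB eB' eA mb0.
have [_ s1] := tnn_coef_sign tA cB mB aB cB' cA la0.
rewrite (sum_supp_setU1_D1 (fun x => col x A) bB eB' lb0) in cA.
have cB2 : #|e |: B :\ b| = d by rewrite card_exchange.
have [|||_ s2] := tnn_coef_sign (a := a) tA cB2 mB' _ _ cA.
- by rewrite !inE ab aB orbT.
- by rewrite !inE (negbTE ce) (negbTE cB') andbF.
- by case: (eqVneq a e) => // ae; rewrite -ae aB in eB'.
have /negbTE ae : a != e by apply: contraNneq eB' => <-.
rewrite ae in s2.
have card_I := card_exchangeI (between a c) bB eB'.
move: s1 s2; rewrite -signr_odd -[X in _ -> 0 < X * _ -> _]signr_odd.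
(* If exactly one of [b] and [e] lay between [a] and [c], the two counts would differ in parity,
   making [la a] and [- la a] both positive. *)
have := congr1 odd card_I; rewrite !oddD.
rewrite !oddb; case: (b \in _); case: (e \in _) => //;
  case: (odd _); case: (odd _) => // _;
  rewrite ?expr0 ?expr1 ?mul1r ?mulN1r => s1 s2;
  by have := addr_gt0 s1 s2; rewrite ?subrr ?addNr ltxx.
Qed.

Definition bridgeable (h : {ffun 'I_n -> option 'I_n}) i j :=
  [/\ (i < j)%N, exists2 p : 'I_n, h i = Some p & (j <= p)%N,
      exists2 q : 'I_n, h j = Some q & (q <= i)%N
    & fixes_between h i j].

Lemma colspan_basis A B : minor A B != 0 -> #|B| = d ->
  colspan A B = fullv.
Proof.
move=> mB cB; have iB := mB; rewrite minor_neq0 // in iB.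
apply/eqP; rewrite eqEdim subvf dimvf /= /dim /= muln1.
by move: iB; rewrite colindep_dim => /eqP ->; rewrite cB.
Qed.

Lemma coloop_in_basis A B x : minor A B != 0 -> #|B| = d ->
  decperm A x = Some x -> x \in B.
Proof.
move=> mB cB /eqP; rewrite decperm_coloop; apply: contraNT => xB.
rewrite (mem_colspanS _ (X := B)) ?colspan_basis ?memvf //.
by apply/subsetP => y yB; rewrite !inE; apply: contraNneq xB => <-.
Qed.

Lemma loop_notin_basis A B x : minor A B != 0 -> #|B| = d ->
  decperm A x = None -> x \notin B.
Proof.
move=> mB cB /decpermPn/eqP x0; rewrite minor_neq0 // in mB.
by apply/negP => /(colindepD1 mB); rewrite x0 mem0v.
Qed.

(** Otherwise column [j] is a combination of [K]. Its expansion involves some [k < i], and some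
    column [x > j] involves [i] in its expansion over [i |: K]; the exchanges [k -> j] and [i -> x]
    then cross. *)
Lemma tnn_basis_exchange A i j K : tnn A -> (i < j)%N ->
  fixes_between (decperm A) i j ->
  col i A \in colspan A [set x : 'I_n | (i < x)%N] ->
  col j A \notin colspan A [set x : 'I_n | (j < x)%N] ->
  #|i |: K| = d -> i \notin K -> j \notin K ->
  minor A (i |: K) != 0 -> minor A (j |: K) != 0.
Proof.
move=> tA ij fixed ilin jlin cK iK jK mi.
have cjK : #|j |: K| = d by rewrite -cK !cardsU1 iK jK.
have := mi; rewrite minor_neq0 // colindepU1 // => /andP[niK iKK].
rewrite minor_neq0 // colindepU1 // iKK andbT; apply/negP => jinK.
have /colspanP[nu nuE] := jinK.
have betw k : k \in i |: K -> (i < k < j)%N -> decperm A k = Some k.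
  move=> kB /fixed; case e: (decperm A k) => [y|] /=; first by move=> ->.
  by move=> _; have := loop_notin_basis mi cK e; rewrite kB.
(* A term lying between [i] and [j] would be a coloop, which no other column can involve. So if no
   term were below [i], later columns would span column [j]. *)
have [k /and3P[kK ki nk]] : exists k : 'I_n, [&& k \in K, (k < i)%N & nu k != 0].
  apply/existsP; apply: contraT; rewrite negb_exists => /forallP nok.
  case/negP: jlin; rewrite nuE; apply: memv_suml => k kK.
  have := nok k; rewrite kK /= negb_and negbK -leqNgt => /orP[ik|/eqP ->]; last first.
    by rewrite scale0r mem0v.
  have [->|nk] := eqVneq (nu k) 0; first by rewrite scale0r mem0v.
  rewrite memvZ // mem_colspan // inE ltnNge; apply/negP => kj.
  have kij : (i < k < j)%N.
    rewrite !ltn_neqAle ik kj !andbT; apply/andP; split.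
      by apply: contraNneq iK => /val_inj ->.
    by apply: contraNneq jK => /val_inj <-.
  have := betw k (setU1r _ kK) kij => /eqP; rewrite decperm_coloop => /negP; apply.
  have := nuE; rewrite (bigD1 k) //= => /eqP; rewrite -subr_eq eq_sym => /eqP.
  move=> /(congr1 (fun w => (nu k)^-1 *: w)); rewrite scalerA mulVf // scale1r => ->.
  rewrite memvZ // memvB ?mem_colspan //.
    by rewrite !inE; apply: contraNneq jK => ->.
  apply: memv_suml => l /andP[lK lk]; rewrite memvZ // mem_colspan // !inE.
  by [].
(* Otherwise all columns after [i], and hence column [i] itself, lie in the span of [K]: those
   between [i] and [j] are zero or belong to [K]. *)
have [x /andP[jx nx]] : exists x : 'I_n, (j < x)%N && (col x A \notin colspan A K).
  apply/existsP; apply: contraT; rewrite negb_exists => /forallP nox.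
  case/negP: niK; suff : (colspan A [set x : 'I_n | (i < x)%N] <= colspan A K)%VS.
    by move/subvP; apply.
  apply/colspan_subvP => x; rewrite inE => ix.
  have [jx|xj] := ltnP j x; first by have := nox x; rewrite jx /= negbK.
  have [->|nxj] := eqVneq x j; first by [].
  have ixj : (i < x < j)%N by rewrite ix ltn_neqAle xj andbT.
  have := fixed _ ixj; case e: (decperm A x) => [y|] /=; last first.
    by move/decpermPn: e => /eqP -> _; rewrite mem0v.
  move=> yx; rewrite yx in e; have := coloop_in_basis mi cK e.
  by rewrite !inE => /orP[/eqP xi|/mem_colspan //]; rewrite xi ltnn in ix.
have : col x A \in colspan A (i |: K) by rewrite colspan_basis ?memvf.
move=> /colspanP[mu muE].
have xK : x \notin K by apply: contra nx; apply: mem_colspan.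
have mu0 : mu i != 0.
  apply: contraNneq nx => mu0; rewrite muE big_setU1 //= mu0 scale0r add0r.
  by apply: memv_suml => l lK; rewrite memvZ ?mem_colspan.
pose nu' y := if y == i then 0 else nu y.
have := @tnn_noncrossing A (i |: K) k i j x nu' mu tA cK mi.
have kni : k != i by rewrite -val_eqE /= ltn_eqF.
rewrite !inE /nu' kK eqxx orbT (negbTE kni) (negbTE jK) (negbTE xK) !orbF /=.
have -> : j != i by rewrite -val_eqE /= gtn_eqF.
have -> : x != i by rewrite -val_eqE /= gtn_eqF // (ltn_trans ij).
have -> : j != x by rewrite -val_eqE /= ltn_eqF.
have aux : (k < i < j)%N || (j < i < k)%N = (k < x < j)%N || (j < x < k)%N -> False.
  by move: ki ij jx; clear; lia.
move=> H; apply: aux.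
apply: H => //.
rewrite big_setU1 //= eqxx scale0r add0r nuE; apply: eq_bigr => y yK.
by case: eqP => // yi; rewrite -yi yK in iK.
Qed.

End TotallyNonnegative.

(** The decorated version of [pi \o (i j)]: for a bridgeable pair, a fixed point created at [j] is a
    loop and one created at [i] is a coloop. *)
Definition bridged n (h : {ffun 'I_n -> option 'I_n}) (i j : 'I_n) :
    {ffun 'I_n -> option 'I_n} :=
  [ffun x => if x == i then h j
             else if x == j then (if h i == Some j then None else h i) else h x].

(** Leaves only two candidates for the permutation after a column operation. *)
Lemma injective_agree_off2 (T : finType) (f g : T -> T) i j : injective f -> injective g ->
  (forall x, x != i -> x != j -> f x = g x) ->
  f i = g i /\ f j = g j \/ f i = g j /\ f j = g i.
Proof.
move=> fi gi fg.
have gb : bijective g by apply: injF_bij.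
have onto x : x = i \/ x = j -> f x = g i \/ f x = g j.
  move=> xij; have [g' gK g'K] := gb.
  have [->|n1] := eqVneq (f x) (g i); first by left.
  have [->|n2] := eqVneq (f x) (g j); first by right.
  have e : f (g' (f x)) = f x.
    rewrite fg ?g'K //.
      by apply: contraNneq n1 => <-; rewrite g'K.
    by apply: contraNneq n2 => <-; rewrite g'K.
  move/fi: e => e; have fx : f x = g x by rewrite -[LHS]g'K e.
  by case: xij => xe; move: n1 n2; rewrite fx xe eqxx.
have [e|nij] := eqVneq i j; first by subst j; case: (onto i (or_intror erefl)) => ->; left.
have := onto _ (or_introl erefl); have := onto _ (or_intror erefl).
move=> [] ej [] ei; rewrite ei ej; auto.
  by move: nij; rewrite (fi i j) ?eqxx // ei.
by move: nij; rewrite (fi i j) ?eqxx // ei.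
Qed.

(** * Adding and removing a bridge *)

Section Bridges.
Variables (R : realFieldType) (d n : nat).
Implicit Types (A : 'M[R]_(d, n)) (X Y B K : {set 'I_n}) (i j a b c e : 'I_n).
Implicit Types h : {ffun 'I_n -> option 'I_n}.

Definition coloops_between h i j : {set 'I_n} := [set y in between j i | h y == Some y].

(* Between [i] and [j] a basis contains exactly the coloops, so that adding
   this multiple of column [i] to column [j] affects all maximal minors with
   the same sign. *)
Definition bridge A i j t := addcol A i j ((-1) ^+ #|coloops_between (decperm A) i j| * t).

Lemma minor_bridge A i j t B : (i < j)%N ->
  fixes_between (decperm A) i j -> #|B| = d ->
  minor (bridge A i j t) B = minor A B +
    if (j \in B) && (i \notin B) then t * minor A (i |: B :\ j) else 0.
Proof.
move=> ij fixed cB; have nij : i != j by rewrite -val_eqE /= ltn_eqF.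
rewrite minor_addcol //; congr (_ + _); case: ifP => // /andP[jB iB].
have [->|m0] := eqVneq (minor A (i |: B :\ j)) 0; first by rewrite !mulr0.
have cB' : #|i |: B :\ j| = d by rewrite card_exchange.
suff -> : coloops_between (decperm A) i j = B :&: between j i.
  by rewrite mulrACA -exprD addnn -mul2n exprM sqrrN !expr1n mul1r.
apply/setP => y; rewrite in_setI inE [RHS]andbC; case: (boolP (y \in between j i)) => //= yij.
have yij' : (i < y < j)%N by move: yij ij; rewrite inE; clear; lia.
have yi : y != i by rewrite -val_eqE /= gtn_eqF //; case/andP: yij'.
have yj : y != j by rewrite -val_eqE /= ltn_eqF //; case/andP: yij'.
have := fixed _ yij'; case e : (decperm A y) => [z|] /=.
  move=> zy; rewrite zy eqxx; apply/esym; rewrite zy in e.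
  by have := coloop_in_basis m0 cB' e; rewrite !inE (negbTE yi) yj.
by move=> _; apply/esym/negbTE; have := loop_notin_basis m0 cB' e; rewrite !inE (negbTE yi) yj.
Qed.

Lemma colspan_bridge A i j t : i != j -> colspan (bridge A i j t) setT = colspan A setT.
Proof. by move=> ij; apply: colspan_addcol; rewrite ?inE. Qed.

Lemma bridge_tnn A i j t : (i < j)%N ->
  fixes_between (decperm A) i j ->
  tnn A -> 0 <= t -> tnn (bridge A i j t).
Proof.
move=> ij fixed tA t0 B cB; rewrite minor_bridge // addr_ge0 ?tA //.
case: ifP => // /andP[jB iB]; rewrite mulr_ge0 // tA // card_exchange //.
Qed.

Lemma decperm_addcol_cases A i j t : (i < j)%N -> fixes_between (decperm A) i j ->
  let pi x := odflt x (decperm A x) in let pi' x := odflt x (decperm (addcol A i j t) x) in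
  pi' i = pi i /\ pi' j = pi j \/ pi' i = pi j /\ pi' j = pi i.
Proof.
move=> ij fixed pi pi'; apply: injective_agree_off2.
- by apply/injectiveP; have := decperm_decperms (addcol A i j t); rewrite inE.
- by apply/injectiveP; have := decperm_decperms A; rewrite inE.
- by move=> x xi xj; rewrite /pi' /pi decperm_addcol.
Qed.

Lemma bridgeable_fixes h i j : bridgeable h i j ->
  fixes_between (bridged h i j) i j.
Proof.
move=> [ij _ _ fixed] y yij; rewrite ffunE -!val_eqE /=.
by case/andP: (yij) => iy yj; rewrite gtn_eqF // ltn_eqF // fixed.
Qed.

(** At most the values at [i] and [j] are swapped. The new column [j] is not spanned by later
    columns, so its value is at most [j]; without a swap this forces [p = j] and makes [j] a coloop,
    yet column [j] is then [t] times column [i]. *)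
Lemma bridge_up A h i j : h \in decperms n -> bridgeable h i j ->
  decperm A = bridged h i j -> forall t, t != 0 -> decperm (addcol A i j t) = h.
Proof.
move=> hD br dA t t0; have [ij [p hi jp] [q hj qi] fixed] := br.
have nij : i != j by rewrite -val_eqE /= ltn_eqF.
have nji : j != i by rewrite eq_sym.
have fixA : fixes_between (decperm A) i j by rewrite dA; apply: bridgeable_fixes.
have Ai : decperm A i = Some q by rewrite dA ffunE eqxx.
have Aj : decperm A j = if p == j then None else Some p.
  rewrite dA ffunE (negbTE nji) eqxx hi.
  case: (eqVneq p j) => [->|pj]; rewrite ?eqxx //.
  by case: eqP => // -[] /eqP; rewrite (negbTE pj).
have ni : col i A \notin colspan A [set x : 'I_n | (j < x)%N].
  have := decperm_gt Ai; rewrite ltnNge qi /= => /esym/negbT.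
  by apply: contra; apply: mem_colspanS; apply/subsetP => x; rewrite !inE; apply: ltn_trans.
have jin : col j A \in colspan A [set x : 'I_n | (j < x)%N].
  move: Aj; case: (eqVneq p j) => [_|pj] e.
    by move/decpermPn: e => /eqP ->; rewrite mem0v.
  by rewrite -(decperm_gt e) ltn_neqAle jp eq_sym pj.
have nj : col j (addcol A i j t) \notin colspan (addcol A i j t) [set x : 'I_n | (j < x)%N].
  rewrite colspan_addcol ?inE ?ltnn // col_addcol eqxx.
  apply: contra ni => H; have := memvB H jin; rewrite addrC addKr => H'.
  by rewrite -[col i A](scale1r) -(mulVf t0) -scalerA memvZ.
have ej : exists k, decperm (addcol A i j t) j = Some k.
  case e : (decperm _ j) => [k|]; first by exists k.
  by move/decpermPn: e => /eqP e; rewrite e mem0v in nj.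
have [k ek] := ej.
have ei : exists l, decperm (addcol A i j t) i = Some l.
  case e : (decperm _ i) => [l|]; first by exists l.
  move/decpermPn: e; rewrite col_addcol (negbTE nij) -decperm_None Ai.
  by [].
have [l el] := ei.
have kj : (k <= j)%N by rewrite leqNgt (decperm_gt ek).
have [[e1 e2]|[e1 e2]] := decperm_addcol_cases t ij fixA.
  exfalso; move: e2; rewrite ek Aj /=; case: (eqVneq p j) => /= [pj kj'|pj kp].
    rewrite kj' in ek; move/eqP: ek; rewrite decperm_coloop => /negP; apply.
    rewrite colspan_addcol ?inE ?eqxx // col_addcol eqxx.
    move: Aj; rewrite pj eqxx => /decpermPn/eqP ->; rewrite add0r memvZ //.
    by rewrite mem_colspan // !inE nij.
  by rewrite kp in kj; move: pj; rewrite -val_eqE /= eqn_leq kj jp.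
apply/ffunP => x; have [->|xi] := eqVneq x i.
  rewrite el hi; move: e1; rewrite el Aj /= => ->.
  by case: (eqVneq p j) => /= [->|].
have [->|xj] := eqVneq x j; first by move: e2; rewrite ek Ai hj /= => ->.
by rewrite decperm_addcol // dA ffunE (negbTE xi) (negbTE xj).
Qed.

Lemma bridge_down A i j : tnn A -> colspan A setT = fullv -> bridgeable (decperm A) i j ->
  exists t, [/\ 0 < t, tnn (bridge A i j (- t)) &
    decperm (bridge A i j (- t)) = bridged (decperm A) i j].
Proof.
move=> tA fA br; have [ij [p hi jp] [q hj qi] fixed] := br.
have nij : i != j by rewrite -val_eqE /= ltn_eqF.
have nji : j != i by rewrite eq_sym.
(* Subtracting turns the minor at [B] into [minor A B - t * minor A (i |: B :\ j)], which stays
   nonnegative up to this ratio; the least ratio over [P] is the [t] sought. *)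
pose ratio B := minor A B / minor A (i |: B :\ j).
pose P B := [&& #|B| == d, j \in B, i \notin B & minor A (i |: B :\ j) != 0].
have gt_i : col i A \in colspan A [set x : 'I_n | (i < x)%N].
  by rewrite -(decperm_gt hi); apply: leq_trans jp.
have gt_j : col j A \notin colspan A [set x : 'I_n | (j < x)%N].
  by rewrite -(decperm_gt hj) -leqNgt (leq_trans qi) // ltnW.
(* [i] is not a loop and [j] is not a coloop, so some basis [Y] contains [i] and omits [j];
   exchanging [i] for [j] in [Y] gives [B0]. *)
have [B0 PB0] : exists B0, P B0.
  have jin : col j A \in colspan A (~: [set j]).
    apply: contraT; rewrite -decperm_coloop hj => /eqP[qj].
    by move: qi; rewrite qj leqNgt ij.
  have iI : colindep A [set i].
    rewrite -(setU0 [set i]) colindepU1 ?inE // colindep0 andbT.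
    by rewrite colspanE big_set0 memv0 -decperm_None hi.
  have [|Y [iY Yj YI sY]] := colindep_ext (X := ~: [set j]) _ iI.
    by rewrite sub1set !inE.
  have {}sY : colspan A Y = fullv.
    by rewrite sY -(colspan_setU1_id jin) setUCr fA.
  have cY : #|Y| = d by apply/eqP; rewrite -(colindep_card_full fA YI) sY.
  have iY' : i \in Y by rewrite -sub1set.
  have jY : j \notin Y by apply/negP => /(subsetP Yj); rewrite !inE eqxx.
  exists (j |: Y :\ i); rewrite /P card_exchange // cY eqxx setU11 !inE (negbTE nij) eqxx /=.
  rewrite (_ : i |: _ = Y) ?minor_neq0 //.
  apply/setP => x; rewrite !inE; case: (eqVneq x i) => [->|] /=; first by rewrite iY'.
  by case: (eqVneq x j) => [->|] //=; rewrite (negbTE jY).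
(* Basis exchange makes every ratio, and hence the minimum, positive. *)
have Ppos B : P B -> minor A B != 0.
  move=> /and4P[/eqP cB jB iB m0].
  rewrite -(setD1K jB); apply: (tnn_basis_exchange tA ij fixed gt_i gt_j) => //.
  - by rewrite card_exchange.
  - by rewrite !inE negb_and iB orbT.
  - by rewrite !inE eqxx.
have [B PB minB] : exists2 B, P B & forall B', P B' -> ratio B <= ratio B'.
  by case: (arg_minP ratio PB0) => B; exists B.
have gt0 B' : P B' -> 0 < minor A (i |: B' :\ j).
  move=> /and4P[/eqP cB jB iB m0]; rewrite lt_def m0 tA //.
  by rewrite card_exchange.
have t0 : 0 < ratio B.
  case/and4P: (PB) => /eqP cB _ _ _.
  by rewrite divr_gt0 ?gt0 // lt_def Ppos // tA.
exists (ratio B); set A' := bridge _ _ _ _.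
have tA' : tnn A'.
  move=> B' cB'; rewrite minor_bridge //; case: ifP => [/andP[jB iB]|_]; last first.
    by rewrite addr0 tA.
  have [->|m0] := eqVneq (minor A (i |: B' :\ j)) 0; first by rewrite mulr0 addr0 tA.
  have PB' : P B' by rewrite /P cB' eqxx jB iB m0.
  by rewrite mulNr subr_ge0 -ler_pdivlMr ?gt0 // minB.
split=> //.
have d_other x : x != i -> x != j -> decperm A' x = decperm A x.
  by move=> xi xj; rewrite /A' decperm_addcol.
have fixed' : fixes_between (decperm A') i j.
  move=> y yij; rewrite d_other ?fixed // -val_eqE /=; case/andP: yij => iy yj.
    by rewrite gtn_eqF.
  by rewrite ltn_eqF.
case/and4P: (PB) => /eqP cB jB iB m0.
have cB' : #|i |: B :\ j| = d by rewrite card_exchange.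
have mB : minor A' B = 0.
  by rewrite minor_bridge // jB iB /= mulNr divfK // subrr.
have mB' : minor A' (i |: B :\ j) != 0.
  by rewrite minor_bridge // !inE (negbTE nji) eqxx addr0.
(* In [A'], the set [i |: B :\ j] is still a basis but [B] no longer is. Basis exchange fails, so
   its two span conditions cannot both hold and the permutation has changed. *)
have no : ~ (col i A' \in colspan A' [set x : 'I_n | (i < x)%N] /\
             col j A' \notin colspan A' [set x : 'I_n | (j < x)%N]).
  move=> [gi gj]; have := tnn_basis_exchange tA' ij fixed' gi gj cB'.
  rewrite setD1K // mB eqxx !inE negb_and iB orbT eqxx => H.
  by have := H isT isT mB'.
have i' : exists l, decperm A' i = Some l.
  case e : (decperm A' i) => [l|]; first by exists l.
  move/decpermPn: e; rewrite /A' col_addcol (negbTE nij) -decperm_None hi.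
  by [].
have [l il] := i'.
have [[e1 e2]|[e1 e2]] := decperm_addcol_cases
  ((-1) ^+ #|coloops_between (decperm A) i j| * - ratio B) ij fixed.
  exfalso; apply: no; move: e1 e2; rewrite -/(bridge _ _ _ _) -/A' il hi hj /= => lp.
  rewrite lp in il; split; first by rewrite -(decperm_gt il); apply: leq_trans jp.
  move: e2; case e : (decperm A' j) => [k|] /= kq; last by rewrite -kq leqNgt ij in qi.
  by rewrite -(decperm_gt e) -leqNgt kq (leq_trans qi) // ltnW.
move: e1 e2; rewrite -/(bridge _ _ _ _) -/A' il hi hj /= => lq e2.
apply/ffunP => x; rewrite [RHS]ffunE; case: (eqVneq x i) => [->|xi]; first by rewrite il hj lq.
case: (eqVneq x j) => [->|xj]; last by rewrite d_other.
(* If [p = j], then [j] is now a fixed point; it is a loop because the basis [i |: B :\ j] omits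
   it. *)
rewrite hi; move: e2; case e : (decperm A' j) => [k|] /= kp; last by rewrite -kp eqxx.
rewrite -kp; case: eqP => // -[kj]; rewrite kj in e.
by have := coloop_in_basis mB' cB' e; rewrite !inE (negbTE nji) eqxx.
Qed.

End Bridges.

(** * Existence of bridges and termination *)

Section BridgeExists.
Variable n : nat.
Implicit Types (h : {ffun 'I_n -> option 'I_n}) (i j x y : 'I_n).

Definition underlying h x := odflt x (h x).

Lemma underlying_inj h : h \in decperms n -> injective (underlying h).
Proof. by rewrite inE => /injectiveP. Qed.

Lemma underlying_bridged h i j : bridgeable h i j ->
  underlying (bridged h i j) =1 underlying h \o tperm i j.
Proof.
move=> [ij [p hi jp] [q hj qi] _] x; rewrite /underlying /= ffunE.
have nij : i != j by rewrite -val_eqE /= ltn_eqF.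
case: tpermP => [->|->|xi xj].
- by rewrite eqxx hj.
- by rewrite eq_sym (negbTE nij) eqxx hi; case: eqP => [[->]|].
- by move/eqP/negbTE: xi => ->; move/eqP/negbTE: xj => ->.
Qed.

Lemma bridged_decperms h i j : h \in decperms n -> bridgeable h i j ->
  bridged h i j \in decperms n.
Proof.
move=> hD br; rewrite inE; apply/injectiveP => x y.
rewrite -!/(underlying _ _) !underlying_bridged // => /(underlying_inj hD).
exact: perm_inj.
Qed.

(** Take the largest [i] with [i < pi i] and the first nonfixed [j] after it. Maximality of [i]
    gives [pi j <= j], and minimality of [j] then rules out [i < pi j]. *)
Lemma bridgeable_exists h x : h \in decperms n -> underlying h x != x ->
  exists i j, bridgeable h i j.
Proof.
move=> hD x0; have pinj := underlying_inj hD; set pi := underlying h in x0 pinj *.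
have pif y : pi y != y -> pi (pi y) != pi y by apply: contraNneq => /pinj ->.
(* The least nonfixed element moves up, its image being nonfixed as well. *)
have [y ey] : exists y, (y < pi y)%N.
  case: (arg_minnP (P := fun z : 'I_n => pi z != z) (@nat_of_ord n) x0) => y yf ymin.
  exists y; rewrite ltn_neqAle ymin ?pif // andbT.
  by rewrite eq_sym.
case: (arg_maxnP (P := fun z : 'I_n => (z < pi z)%N) (@nat_of_ord n) ey) => i ei imax.
have pii : pi (pi i) != pi i by apply: pif; rewrite -val_eqE /= gtn_eqF.
have Pi : (pi (pi i) != pi i) && (i < pi i)%N by rewrite pii ei.
case: (arg_minnP (i0 := pi i) (P := fun z : 'I_n => (pi z != z) && (i < z)%N)
  (@nat_of_ord n) Pi) => j /andP[jf ij] jmin.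
exists i, j.
have hz z : pi z != z -> exists2 p, h z = Some p & pi z = p.
  by rewrite /pi /underlying; case: (h z) => [p|] /=; [exists p|rewrite eqxx].
split=> //.
- have [|p hp pe] := hz i; first by rewrite -val_eqE /= gtn_eqF.
  by exists p => //; rewrite -pe jmin.
- have [q hq qe] := hz j jf; exists q => //; rewrite -qe leqNgt; apply/negP => iq.
  have lej : (pi j <= j)%N.
    by rewrite leqNgt; apply/negP => /imax /=; rewrite leqNgt ij.
  have : (j <= pi j)%N by apply: jmin; rewrite pif.
  move: jf; rewrite -val_eqE /=; move: lej; clear; lia.
- move=> z /andP[iz zj]; apply/eqP; apply: contraLR zj => zf.
  by rewrite -leqNgt jmin // iz andbT.
Qed.

(** Truncated subtraction keeps only upward displacements. Bridging replaces a contribution [p - i]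
    by [p - j], so this serves as induction measure. *)
Definition excess h := (\sum_x (underlying h x - x))%N.

Lemma excess_bridged h i j : bridgeable h i j -> (excess (bridged h i j) < excess h)%N.
Proof.
move=> br; have [ij [p hi jp] [q hj qi] fixed] := br.
have nij : i != j by rewrite -val_eqE /= ltn_eqF.
rewrite /excess (bigD1 i) //= (bigD1 j) //=; last by rewrite eq_sym.
rewrite [X in (_ < X)%N](bigD1 i) //= [X in (_ < _ + X)%N](bigD1 j) //=; last first.
  by rewrite eq_sym.
rewrite !underlying_bridged // /= tpermL tpermR /underlying hi hj /=.
rewrite (eq_bigr (fun x => (odflt x (h x) - x)%N)); last first.
  by move=> x /andP[xi xj]; rewrite -[odflt x _]/(underlying (bridged h i j) x);
    rewrite underlying_bridged //= tpermD 1?eq_sym.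
move: (\sum_(_ | _) _)%N => s; move: ij jp qi; clear; lia.
Qed.

End BridgeExists.

(** * Decorated permutations that move no point *)

Section BaseCase.
Variables (R : realFieldType) (n : nat) (h : {ffun 'I_n -> option 'I_n}).
Hypothesis hfix : forall x, underlying h x = x.

Let S := [set x | h x == Some x].

Lemma fixed_None x : x \notin S -> h x = None.
Proof.
have := hfix x; rewrite inE /underlying; case: (h x) => [y|] //= ->.
by rewrite eqxx.
Qed.

(** The rows are the unit vectors indexed by the coloops [S]; the only nonzero maximal minor is the
    one at [S]. *)
Lemma tnn_exists_fixed : exists d (A : 'M[R]_(d, n)),
  [/\ tnn A, colspan A setT = fullv & decperm A = h].
Proof.
have [f fi fS] := incr_exists (erefl #|S|).
pose A : 'M[R]_(#|S|, n) := \matrix_(k, x) (f k == x)%:R.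
have mS : minor A S = 1.
  have := minor_incr A fi; rewrite fS => ->.
  rewrite (_ : colsub f A = 1%:M) ?det1 //.
  by apply/matrixP => k l; rewrite !mxE (inj_eq (incr_inj fi)).
have out x : x \notin S -> col x A = 0.
  move=> xS; apply/colP => k; rewrite !mxE; case: eqP => // fx.
  by move: xS; rewrite -fx -{1}fS imset_f.
have mB (B : {set 'I_n}) : #|B| = #|S| -> B != S -> minor A B = 0.
  move=> cB BS; apply/eqP; apply: contraT; rewrite minor_neq0 // => iB.
  have /subsetPn[x xB xS] : ~~ (B \subset S).
    by apply: contra BS => sub; rewrite eqEcard sub cB /=.
  by have := colindepD1 iB xB; rewrite out // mem0v.
have mS0 : minor A S != 0 by rewrite mS oner_eq0.
exists #|S|, A; split.
- move=> B cB; have [->|BS] := eqVneq B S; first by rewrite mS ler01.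
  by rewrite mB.
- by apply/eqP; rewrite eqEsubv subvf -(colspan_basis mS0 erefl) colspanS ?subsetT.
- apply/ffunP => x; have [xS|xS] := boolP (x \in S); last first.
    by rewrite fixed_None //; apply/decpermPn; rewrite out.
  have /eqP -> : h x == Some x by move: xS; rewrite inE.
  apply/eqP; rewrite decperm_coloop; rewrite minor_neq0 // in mS0.
  apply: contra (colindepD1 mS0 xS).
  suff /subvP : (colspan A [set~ x] <= colspan A (S :\ x))%VS by apply.
  apply/colspan_subvP => y; rewrite !inE => yx.
  by have [yS|/out ->] := boolP (y \in S); rewrite ?mem0v // mem_colspan // in_setD1 yx.
Qed.

Lemma colindep_fixed d (A : 'M[R]_(d, n)) X : decperm A = h ->
  colindep A X = (X \subset S).
Proof.
move=> dA; apply/idP/idP => [iX|XS].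
  apply/subsetP => x xX; apply: contraT => /fixed_None; rewrite -dA => /decpermPn/eqP x0.
  by have := colindepD1 iX xX; rewrite x0 mem0v.
apply: colindepS XS _.
have [Y [_ YS iY sY]] := colindep_ext (sub0set S) (colindep0 A).
suff : S \subset Y by move=> SY; apply: colindepS SY iY.
apply/subsetP => x xS; apply: contraT => xY.
have := xS; rewrite inE -dA decperm_coloop => /negP[].
rewrite (mem_colspanS _ (X := Y)) ?sY ?mem_colspan //.
by apply/subsetP => y yY; rewrite !inE; apply: contraNneq xY => <-.
Qed.

End BaseCase.

(** * Classification of totally nonnegative matrices by decorated permutations *)

Section Classification.
Variables (R : realFieldType) (n : nat).
Implicit Types (h : {ffun 'I_n -> option 'I_n}) (i j x y : 'I_n).

Lemma fixed_or_bridgeable h : h \in decperms n ->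
  (forall x, underlying h x = x) \/ exists i j, bridgeable h i j.
Proof.
move=> hD; have [/forallP fx|] := boolP [forall x, underlying h x == x].
  by left=> x; apply/eqP.
by rewrite negb_forall => /existsP[x xf]; right; apply: bridgeable_exists xf.
Qed.

Lemma tnn_exists h : h \in decperms n -> exists d (A : 'M[R]_(d, n)),
  [/\ tnn A, colspan A setT = fullv & decperm A = h].
Proof.
have [m] := ubnP (excess h); elim: m h => // m IH h hm hD.
have [hfix|[i [j br]]] := fixed_or_bridgeable hD; first exact: tnn_exists_fixed.
have [||d [A [tA fA dA]]] := IH (bridged h i j).
- by have := excess_bridged br; move: hm; clear; lia.
- exact: bridged_decperms.
have [ij _ _ _] := br; have nij : i != j by rewrite -val_eqE /= ltn_eqF.
exists d, (bridge A i j 1); split.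
- by apply: bridge_tnn => //; rewrite ?ler01 // dA; apply: bridgeable_fixes.
- by rewrite colspan_bridge.
- by apply: bridge_up => //; rewrite mulr1 signr_eq0.
Qed.

Lemma full_dim_le d1 d2 (A1 : 'M[R]_(d1, n)) (A2 : 'M[R]_(d2, n)) :
  colspan A1 setT = fullv -> colindep A1 =1 colindep A2 -> (d1 <= d2)%N.
Proof.
move=> f1 e; have [B [_ _ iB sB]] := colindep_ext (sub0set setT) (colindep0 A1).
have /eqP <- : #|B| == d1 by rewrite -(colindep_card_full f1 iB) sB f1.
move: iB; rewrite e colindep_dim => /eqP <-.
by rewrite -[X in (_ <= X)%N]muln1 -[(_ * 1)%N](dimvf 'cV[R]_d2) dimvS ?subvf.
Qed.

(** Two nonnegative terms cannot cancel. The new bases thus depend only on the old matroid, [i] and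
    [j], not on the value of [t]. *)
Lemma minor_bridge_neq0 d (A : 'M[R]_(d, n)) i j t (B : {set 'I_n}) :
  tnn A -> 0 < t -> (i < j)%N -> fixes_between (decperm A) i j -> #|B| = d ->
  (minor (bridge A i j t) B != 0) =
  colindep A B || [&& j \in B, i \notin B & colindep A (i |: B :\ j)].
Proof.
move=> tA t0 ij fixed cB; rewrite minor_bridge // -(minor_neq0 A cB).
case: (boolP (j \in B)) => jB /=; last by rewrite addr0 orbF.
case: (boolP (i \in B)) => iB /=; first by rewrite addr0 orbF.
have cB' : #|i |: B :\ j| = d by rewrite card_exchange.
rewrite -(minor_neq0 A cB') paddr_eq0 ?tA //; last by rewrite mulr_ge0 ?tA // ltW.
by rewrite negb_and mulf_eq0 (gt_eqF t0).
Qed.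

(** Bridging keeps the coloops strictly between [i] and [j], so both operations carry the same sign
    and their multiples cancel. *)
Lemma bridgeK d (A : 'M[R]_(d, n)) i j t : bridgeable (decperm A) i j ->
  decperm (bridge A i j (- t)) = bridged (decperm A) i j ->
  bridge (bridge A i j (- t)) i j t = A.
Proof.
move=> [ij _ _ _] dA; rewrite {1}/bridge dA.
have -> : coloops_between (bridged (decperm A) i j) i j = coloops_between (decperm A) i j.
  apply/setP => y; rewrite inE [RHS]inE; case: (boolP (y \in between j i)) => //=.
  rewrite inE ffunE => yij.
  have -> : (y == i) = false by apply/negbTE; move: yij; rewrite -val_eqE /=; clear; lia.
  by have -> : (y == j) = false by apply/negbTE; move: yij; rewrite -val_eqE /=; clear; lia.
rewrite /bridge; set s := (-1) ^+ _.
have -> : s * t = - (s * - t) by rewrite mulrN opprK.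
by rewrite addcolK // -val_eqE /= ltn_eqF.
Qed.

(** Both matrices are reduced to [bridged h i j], of smaller excess. By induction the reduced
    matroids agree, and adding the bridge back acts on their bases in the same way. *)
Lemma tnn_unique h d1 d2 (A1 : 'M[R]_(d1, n)) (A2 : 'M[R]_(d2, n)) :
  tnn A1 -> colspan A1 setT = fullv -> decperm A1 = h ->
  tnn A2 -> colspan A2 setT = fullv -> decperm A2 = h ->
  colindep A1 =1 colindep A2.
Proof.
have [m] := ubnP (excess h); elim: m h d1 d2 A1 A2 => // m IH h d1 d2 A1 A2 hm.
move=> t1 f1 e1 t2 f2 e2.
have hD : h \in decperms n by rewrite -e1 decperm_decperms.
have [hfix|[i [j br]]] := fixed_or_bridgeable hD.
  by move=> X; rewrite !(colindep_fixed hfix).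
have br1 := br; rewrite -e1 in br1; have br2 := br; rewrite -e2 in br2.
have [s1 [s10 tB1 eB1]] := bridge_down t1 f1 br1.
have [s2 [s20 tB2 eB2]] := bridge_down t2 f2 br2.
have [ij _ _ _] := br; have nij : i != j by rewrite -val_eqE /= ltn_eqF.
have eB : colindep (bridge A1 i j (- s1)) =1 colindep (bridge A2 i j (- s2)).
  apply: (IH (bridged h i j)) => //; rewrite ?colspan_bridge ?eB1 ?eB2 ?e1 ?e2 //.
  by have := excess_bridged br; move: hm; clear; lia.
(* The number of rows is the rank, which the matroid determines. *)
have d12 : d1 = d2.
  apply/eqP; rewrite eqn_leq (full_dim_le _ eB) ?colspan_bridge //=.
  by rewrite (full_dim_le (A1 := bridge A2 i j (- s2)) _ (fsym eB)) ?colspan_bridge.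
subst d2; move=> X; rewrite !colindep_basis //; apply: eq_existsb => B; congr (_ && _).
case: eqP => //= cB.
rewrite -(bridgeK br1 eB1) -(bridgeK br2 eB2).
have fx1 := bridgeable_fixes br1; have fx2 := bridgeable_fixes br2.
by rewrite !minor_bridge_neq0 ?eB1 ?eB2 ?eB.
Qed.

End Classification.

(** * Connectedness and stable intervals *)

Section Irreducible.
Variable n : nat.
Implicit Types (h : {ffun 'I_n -> option 'I_n}) (B J : {set 'I_n}).

Definition stable h J := [forall x in J, underlying h x \in J].

(** Elements outside [B] are ignored, so that relabelling [B] increasingly turns relative intervals
    into intervals. *)
Definition interval_of B J := (J \subset B) &&
  [forall x in J, forall z in J, forall y in B, (x < y < z)%N ==> (y \in J)].

Definition irreducible_on B h :=
  [forall J : {set 'I_n}, [&& interval_of B J, J != set0 & stable h J] ==> (J == B)].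

Lemma stableP h J : reflect {in J, forall x, underlying h x \in J} (stable h J).
Proof. exact: forall_inP. Qed.

Lemma interval_ofP B J : reflect
  (J \subset B /\ forall x y z, x \in J -> y \in B -> z \in J -> (x < y < z)%N -> y \in J)
  (interval_of B J).
Proof.
apply: (iffP andP) => -[JB H]; split=> //.
  move=> x y z xJ yB zJ.
  by move/forall_inP/(_ x xJ)/forall_inP/(_ z zJ)/forall_inP/(_ y yB)/implyP: H.
apply/forall_inP => x xJ; apply/forall_inP => z zJ; apply/forall_inP => y yB.
by apply/implyP; apply: H xJ yB zJ.
Qed.

End Irreducible.

(** * Separators of the column matroid *)

Section Separators.
Variables (F : fieldType) (d n : nat) (A : 'M[F]_(d, n)).
Implicit Types (S X Y B J : {set 'I_n}).

(** Additivity of the rank: [S] is a union of connected components of the matroid. *)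
Definition separator S :=
  (\dim (colspan A S) + \dim (colspan A (~: S)) == \dim (colspan A setT))%N.

Lemma separatorC S : separator (~: S) = separator S.
Proof. by rewrite /separator setCK addnC. Qed.

Lemma dim_colspanU_le X Y :
  (\dim (colspan A (X :|: Y)) <= \dim (colspan A X) + \dim (colspan A Y))%N.
Proof. by rewrite colspanU -dimv_sum_cap leq_addr. Qed.

Lemma separator_cap S : separator S = (colspan A S :&: colspan A (~: S) == 0)%VS.
Proof.
rewrite /separator -(setUCr S) colspanU -dimv_sum_cap -{2}[\dim (_ + _)]addn0 eqn_add2l.
by rewrite dimv_eq0.
Qed.

Lemma separator_sub S X : separator S -> X \subset S ->
  (\dim (colspan A X) + \dim (colspan A (S :\: X)) <= \dim (colspan A S))%N ->
  separator X.
Proof.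
rewrite /separator => /eqP sS XS le; rewrite eqn_leq -{2}(setUCr X) dim_colspanU_le andbT.
rewrite -sS; apply: leq_trans (leq_add le (leqnn _)).
rewrite -addnA leq_add2l.
have -> : ~: X = (S :\: X) :|: ~: S.
  apply/setP => x; rewrite !inE.
  case: (boolP (x \in S)) => xS; rewrite ?andbT ?orbF ?orbT //=.
  by apply: contra xS; apply: (subsetP XS).
exact: dim_colspanU_le.
Qed.

Lemma colindep_separator S X Y : separator S -> X \subset S -> Y \subset ~: S ->
  colindep A X -> colindep A Y -> colindep A (X :|: Y).
Proof.
rewrite separator_cap => /eqP c0 XS YS; rewrite !colindep_dim => /eqP iX /eqP iY.
have XY : X :&: Y = set0.
  apply/setP => x; rewrite !inE; apply/negP => /andP[/(subsetP XS) xS /(subsetP YS)].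
  by rewrite inE xS.
rewrite cardsU XY cards0 subn0 -iX -iY -dimv_sum_cap -colspanU.
rewrite (_ : (_ :&: _)%VS = 0%VS) ?dimv0 ?addn0 //.
by apply/eqP; rewrite -subv0 -c0; apply: capvS; apply: colspanS.
Qed.

(** Extend a basis of [X] to a basis of [S]. If its part in [Y] spanned [Y], the ranks would add up;
    a column [c] of [Y] missed by that span involves a basis element outside [Y]. *)
Lemma basis_crossing S X Y : S = X :|: Y -> [disjoint X & Y] ->
  (\dim (colspan A S) < \dim (colspan A X) + \dim (colspan A Y))%N ->
  exists B a c la, [/\ B \subset S, colindep A B, a \in B :&: X, c \in Y :\: B &
    col c A = \sum_(x in B) la x *: col x A /\ la a != 0].
Proof.
move=> SE dXY lt.
have [B' [_ B'X iB' sB']] := colindep_ext (sub0set X) (colindep0 A).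
have B'S : B' \subset S by rewrite SE (subset_trans B'X) ?subsetUl.
have [B [B'B BS iB sB]] := colindep_ext B'S iB'.
have [c cY nc] : exists2 c, c \in Y & col c A \notin colspan A (B :&: Y).
  apply/exists_inP; apply: contraT; rewrite negb_exists_in => /forall_inP allY.
  suff /dimvS le : (colspan A Y <= colspan A (B :&: Y))%VS.
    move: lt; rewrite -sB -sB' ltnNge => /negP[].
    have iBY : colindep A (B :&: Y) by apply: colindepS iB; apply: subsetIl.
    move: iB' iB iBY; rewrite !colindep_dim => /eqP -> /eqP -> /eqP iBY; rewrite iBY in le.
    apply: (leq_trans (leq_add (leqnn _) le)).
    rewrite -cardsUI (_ : B' :&: _ = set0) ?cards0 ?addn0.
      by apply: subset_leq_card; rewrite subUset B'B subsetIl.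
    apply/setP => x; rewrite !inE; apply/negP => /and3P[/(subsetP B'X) xX _ xY].
    by move/pred0P/(_ x): dXY; rewrite /= xX xY.
  by apply/colspan_subvP => y /allY; rewrite negbK.
have cB : c \notin B by apply: contra nc => cB; rewrite mem_colspan // inE cB.
have /colspanP[la e] : col c A \in colspan A B by rewrite sB mem_colspan // SE inE cY orbT.
have [a aB /andP[aY la0]] : exists2 a, a \in B & (a \notin Y) && (la a != 0).
  apply/exists_inP; apply: contraT; rewrite negb_exists_in => /forall_inP none.
  move: nc; rewrite e memv_suml // => x xB; have := none x xB.
  rewrite negb_and !negbK => /orP[xY|/eqP ->]; last by rewrite scale0r mem0v.
  by rewrite memvZ // mem_colspan // inE xB.
exists B, a, c, la; split=> //; last by rewrite !inE cB.
by have := subsetP BS a aB; rewrite SE !inE aB (negbTE aY) orbF.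
Qed.

(** In the direct sum decomposition, the part of column [x] coming from outside [S] vanishes. Were
    the image [j] outside [S], the columns of [arc x j] would already span column [x]. *)
Lemma separator_stable S : separator S -> stable (decperm A) S.
Proof.
rewrite separator_cap => /eqP c0; apply/stableP => x xS; rewrite /underlying.
case e : (decperm A x) => [j|] //=; have /decpermP/andP[xj nxj] := e.
apply: contraT => jS; case/negP: nxj.
have : col x A \in colspan A ((j |: arc x j) :&: S :|: (j |: arc x j) :\: S) by rewrite setID.
rewrite colspanU => /memv_addP[u uS [v vS xuv]].
have v0 : v = 0.
  apply/eqP; rewrite -memv0 -c0 memv_cap; apply/andP; split.
    have -> : v = col x A - u by rewrite xuv addrC addKr.
    by rewrite memvB ?mem_colspan // (mem_colspanS _ uS) // subsetIr.
  by rewrite (mem_colspanS _ vS) // setDE subsetIr.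
rewrite xuv v0 addr0 (mem_colspanS _ uS) //; apply/subsetP => y; rewrite !inE.
case/andP => /orP[/eqP ->|//]; by rewrite (negbTE jS).
Qed.

(** The elements of [J] are added to its complement in decreasing order. Each column spanned by the
    later elements of [J] and the complement is shown to be spanned by the former alone, so the
    ranks keep adding up. *)
Lemma stable_separator J : interval_of setT J -> stable (decperm A) J -> separator J.
Proof.
move=> /interval_ofP[_ cJ] /stableP sJ.
suff H (m : nat) : (m <= n)%N -> (\dim (colspan A ([set x in J | n - m <= x] :|: ~: J)) =
    \dim (colspan A [set x in J | n - m <= x]) + \dim (colspan A (~: J)))%N.
  have := H n (leqnn n); rewrite subnn (_ : [set _ in _ | _] = J) ?setUCr => [e|].
    by rewrite /separator e.
  by apply/setP => x; rewrite !inE andbT.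
elim: m => [_|m IH mn].
  rewrite subn0 (_ : [set _ in _ | _] = set0).
    by rewrite set0U [colspan A set0]colspanE big_set0 dimv0.
  by apply/setP => x; rewrite !inE leqNgt ltn_ord andbF.
have {}IH := IH (ltnW mn).
have kn : (n - m.+1 < n)%N by lia.
pose k := Ordinal kn; have [kJ|kJ] := boolP (k \in J); last first.
  rewrite (_ : [set x in J | (n - m.+1 <= x)%N] = [set x in J | (n - m <= x)%N]) //.
  apply/setP => x; rewrite !inE; case: (boolP (x \in J)) => //= xJ.
  have : x != k by apply: contraNneq kJ => <-.
  rewrite -val_eqE /=; move: mn; clear; lia.
have -> : [set x in J | (n - m.+1 <= x)%N] = k |: [set x in J | (n - m <= x)%N].
  apply/setP => x; rewrite !inE; case: (eqVneq x k) => [->|]; first by rewrite kJ /= leqnn.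
  rewrite -val_eqE /=; case: (x \in J) => //=; move: mn; clear; lia.
set J' := [set x in J | _] in IH *.
have dimU1 X : \dim (colspan A (k |: X)) =
    (\dim (colspan A X) + (col k A \notin colspan A X))%N.
  have [kX|kX] := boolP (col k A \in colspan A X); first by rewrite colspan_setU1_id // addn0.
  have [Y [_ YX iY sY]] := colindep_ext (sub0set X) (colindep0 A).
  have kY : k \notin Y.
    by apply: contra kX => kY; rewrite -sY mem_colspan.
  have : colindep A (k |: Y) by rewrite colindepU1 // sY kX.
  move: iY; rewrite !colindep_dim cardsU1 kY colspanU sY -colspanU => /eqP -> /eqP ->.
  by rewrite addnC.
rewrite -setUA !dimU1 IH addnAC; congr (_ + nat_of_bool (~~ _) + _)%N.
apply/idP/idP => [|]; last by apply: mem_colspanS; apply: subsetUl.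
have := sJ _ kJ; rewrite /underlying; case e : (decperm A k) => [p|] /= pJ kin; last first.
  by move/decpermPn/eqP: e => ->; rewrite mem0v.
have /decpermP/andP[kp nkp] := e.
(* If [k < p], the elements from [k + 1] to [p] all lie in [J]. If [p <= k], those from [p] to [k]
   do, so the later elements of [J] and its complement lie in [arc k p], which does not span column
   [k]. *)
have [ltkp|lepk] := ltnP k p.
  rewrite (mem_colspanS _ kp) //; apply/subsetP => x xa.
  have /andP[kx xp] : (k < x <= p)%N.
    move: xa ltkp (ltn_ord x) (ltn_ord p) (cycP k x) (cycP k p); rewrite arcU1 inE; clear.
    lia.
  rewrite inE; apply/andP; split.
    have [->//|xnp] := eqVneq x p.
    by apply: (cJ k _ p); rewrite ?inE // kx ltn_neqAle xnp.
  by move: kx; rewrite /= ; clear; lia.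
case/negP: nkp; apply: mem_colspanS kin; apply/subsetP => x xJ.
rewrite inE; suff : (k < x)%N || (x < p)%N.
  by move: lepk (ltn_ord x) (ltn_ord p) (cycP k x) (cycP k p); clear; lia.
move: xJ; rewrite !inE => /orP[/andP[xJ xk]|xJ].
  by apply/orP; left; move: xk; rewrite /= ; move: mn; clear; lia.
apply: contraR xJ; rewrite negb_or -!leqNgt => /andP[xk px].
have [->//|xnk] := eqVneq x k; have [->//|xnp] := eqVneq x p.
by apply: (cJ p _ k); rewrite ?inE // !ltn_neqAle px xk xnk eq_sym xnp.
Qed.

End Separators.

Section Connectedness.
Variables (R : realFieldType) (d n : nat) (A : 'M[R]_(d, n)).
Hypotheses (tA : tnn A) (fA : colspan A setT = fullv).
Implicit Types (S X Y B J : {set 'I_n}).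

(** Since [S] is a separator, [B1] and [B2] extend to a common basis. The two expansions persist
    there with disjoint supports, so [tnn_noncrossing] applies. *)
Lemma separators_noncrossing S (B1 B2 : {set 'I_n}) a b c e la mu :
  separator A S -> B1 \subset S -> B2 \subset ~: S ->
  colindep A B1 -> colindep A B2 ->
  a \in B1 -> c \in S :\: B1 -> col c A = \sum_(x in B1) la x *: col x A -> la a != 0 ->
  b \in B2 -> e \in ~: S :\: B2 -> col e A = \sum_(x in B2) mu x *: col x A -> mu b != 0 ->
  (a \in between b e) = (c \in between b e).
Proof.
move=> sS B1S B2S i1 i2 aB1 cS cE la0 bB2 eS eE mb0.
have iU := colindep_separator sS B1S B2S i1 i2.
have [B [UB _ iB sB]] := colindep_ext (subsetT _) iU.
have cB : #|B| = d by apply/eqP; rewrite -(colindep_card_full fA iB) sB fA.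
have mB : minor A B != 0 by rewrite minor_neq0.
have B1B : B1 \subset B by rewrite (subset_trans _ UB) ?subsetUl.
have B2B : B2 \subset B by rewrite (subset_trans _ UB) ?subsetUr.
have ext (X : {set 'I_n}) (nu : 'I_n -> R) : X \subset B -> \sum_(x in X) nu x *: col x A =
    \sum_(x in B) (if x \in X then nu x else 0) *: col x A.
  move=> XB; rewrite [RHS](bigID (mem X)) /= [X in _ + X]big1 ?addr0.
    apply: eq_big => [x|x ->//]; case: (boolP (x \in X)) => xX; rewrite ?andbF //.
    by rewrite (subsetP XB).
  by move=> x /andP[_ /negbTE ->]; rewrite scale0r.
have notin (X : {set 'I_n}) x (nu : 'I_n -> R) : X \subset B -> x \notin X ->
    col x A = \sum_(x in X) nu x *: col x A -> x \notin B.
  move=> XB xX xE; apply/negP => /(colindepD1 iB)/negP[].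
  rewrite xE memv_suml // => y yX; rewrite memvZ // mem_colspan // !inE (subsetP XB) // andbT.
  by apply: contraNneq xX => <-.
case/setDP: (cS) => cS' cB1; case/setDP: (eS) => eS' eB2.
have dis x y : x \in S -> y \in ~: S -> x != y.
  by move=> xS; apply: contraTneq => <-; rewrite inE xS.
have aS := subsetP B1S _ aB1; have bS := subsetP B2S _ bB2.
have aB2 : a \notin B2 by apply/negP => /(subsetP B2S); rewrite inE aS.
apply: (tnn_noncrossing tA cB mB (subsetP B2B _ bB2) (subsetP B1B _ aB1) _
  (notin _ _ _ B2B eB2 eE) (notin _ _ _ B1B cB1 cE) _ _ _ _ _ _).
- by rewrite eq_sym dis.
- by rewrite eq_sym dis.
- by rewrite eE; apply: ext.
- by rewrite /= bB2.
- by rewrite /= (negbTE aB2).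
- by rewrite cE; apply: ext.
- by rewrite /= aB1.
Qed.

(* [E1] is a minimal separator containing the first element and [J] its first
   gap. A minimal separator [E2] meeting [J] and leaving it would give an
   exchange [b -> e] in [E2] with [b] in and [e] outside [J], and then an exchange
   [a -> c] in [E1] into the part of [E1] between [b] and [e], crossing it. *)
Lemma separator_reducible S : separator A S -> S != set0 -> S != setT ->
  ~~ irreducible_on setT (decperm A).
Proof.
move=> sS S0 ST; have /set0Pn[s _] := S0.
have n0 : (0 < n)%N by apply: leq_ltn_trans (ltn_ord s).
pose o := Ordinal n0.
pose P1 X := [&& separator A X, o \in X & X != setT].
have [X PX] : exists X, P1 X.
  have [oS|oS] := boolP (o \in S); first by exists S; rewrite /P1 sS oS ST.
  exists (~: S); rewrite /P1 separatorC sS inE oS /=.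
  by apply: contra S0 => /eqP e; rewrite -(setCK S) e setCT.
case: (arg_minnP (i0 := X) (P := P1) (fun X => #|X|) PX) => E1 /and3P[sE oE ET] minE.
have {}minE Y : Y \proper E1 -> o \in Y -> ~~ separator A Y.
  move=> pY oY; apply/negP => sY; have : P1 Y.
    rewrite /P1 sY oY; apply: contraTneq pY => ->.
    by rewrite properE subsetT andbC; apply/negP => /andP[/negP].
  by move/minE; rewrite leqNgt proper_card.
have [y0 y0E] : exists y, y \notin E1.
  by move: ET; rewrite -subTset => /subsetPn[y _ yE]; exists y.
case: (arg_minnP (i0 := y0) (P := fun y => y \notin E1) (@nat_of_ord n) y0E) => y yE ymin.
pose J := [set x : 'I_n | (y <= x)%N && [forall z in E1, (y < z)%N ==> (x < z)%N]].
have JP (x : 'I_n) : reflect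
    ((y <= x)%N /\ forall z : 'I_n, z \in E1 -> (y < z)%N -> (x < z)%N) (x \in J).
  rewrite inE; apply: (iffP andP) => -[yx H]; split=> //.
    by move=> z zE; apply/implyP; move/forall_inP: H; apply.
  by apply/forall_inP => z zE; apply/implyP; apply: H.
have JN (x : 'I_n) : x \notin J -> (y <= x)%N -> exists2 z, z \in E1 & (y < z <= x)%N.
  rewrite inE => + yx; rewrite yx /= negb_forall_in => /exists_inP[z zE].
  by rewrite negb_imply -leqNgt => yzx; exists z.
move: J JP JN => J JP JN.
have yJ : y \in J by apply/JP; split.
have JE x : x \in J -> x \notin E1.
  move=> /JP[yx H]; apply/negP => xE.
  have : (x < x)%N.
    by apply: H => //; rewrite ltn_neqAle yx andbT; apply: contraNneq yE => /val_inj ->.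
  by rewrite ltnn.
rewrite negb_forall; apply/existsP; exists J; rewrite negb_imply.
apply/andP; split; last first.
  by apply: contraTneq oE => JT; apply: JE; rewrite JT.
apply/and3P; split.
- apply/interval_ofP; split; first exact: subsetT.
  move=> u v w /JP[yu _] _ /JP[_ Hw] /andP[uv vw]; apply/JP; split.
    by apply: leq_trans yu (ltnW uv).
  by move=> z zE yz; apply: ltn_trans vw (Hw z zE yz).
- by apply/set0Pn; exists y.
apply/stableP => x xJ.
pose P2 Y := [&& separator A Y, Y \subset ~: E1 & x \in Y].
have P2E : P2 (~: E1) by rewrite /P2 separatorC sE subxx inE JE.
case: (arg_minnP (i0 := ~: E1) (P := P2) (fun X => #|X|) P2E) => E2 /and3P[sE2 E2E xE2] minE2.
have /stableP st2 := separator_stable sE2.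
suff sub : E2 \subset J by apply: (subsetP sub); apply: st2.
apply: contraT => /subsetPn[d0 d0E d0J].
have nsep2 : ~~ separator A (E2 :&: J).
  apply/negP => s2; have : P2 (E2 :&: J).
    by rewrite /P2 s2 inE xE2 xJ (subset_trans _ E2E) // subsetIl.
  move/minE2; rewrite leqNgt => /negP[]; apply: proper_card.
  by rewrite properE subsetIl; apply/subsetPn; exists d0; rewrite // inE negb_and d0J orbT.
have [B2 [b [e [mu [B2E i2 bB eB [eE mb]]]]]] :
    exists B a c la, [/\ B \subset E2, colindep A B, a \in B :&: (E2 :&: J),
      c \in (E2 :\: J) :\: B &
    col c A = \sum_(x in B) la x *: col x A /\ la a != 0].
  apply: basis_crossing; first by rewrite setID.
    by rewrite -setI_eq0; apply/eqP/setP => u; rewrite !inE; case: (u \in J); rewrite ?andbF.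
  rewrite ltnNge; apply: contra nsep2 => le.
  apply: separator_sub sE2 _ _; first exact: subsetIl.
  by rewrite setDIr setDv set0U.
move: bB eB; rewrite !inE => /and3P[bB2 bE2 bJ] /and3P[eB2 eJ eE2].
have [yb bz] := JP _ bJ.
have ye : (y <= e)%N by apply: ymin; have := subsetP E2E _ eE2; rewrite inE.
have [z zE /andP[yz ze]] : exists2 z, z \in E1 & (y < z < e)%N.
  have [z zE /andP[yz ze]] := JN e eJ ye; exists z => //.
  rewrite yz ltn_neqAle ze andbT; apply: contraTneq (subsetP E2E _ eE2) => /val_inj <-.
  by rewrite inE zE.
have bze := bz _ zE yz.
pose X1 := [set u in E1 | (b < u < e)%N].
have oX1 : o \notin X1 by rewrite inE andbF.
have nsep1 : ~~ separator A (E1 :\: X1).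
  apply: minE; last by rewrite in_setD oX1.
  rewrite properE subsetDl; apply/subsetPn; exists z => //.
  by rewrite !inE zE bze ze.
have [B1 [a [c [la [B1E i1 aB cB [cE la0]]]]]] :
    exists B a c la, [/\ B \subset E1, colindep A B, a \in B :&: (E1 :\: X1), c \in X1 :\: B &
    col c A = \sum_(x in B) la x *: col x A /\ la a != 0].
  have X1E : X1 \subset E1 by apply/subsetP => u; rewrite inE => /andP[].
  apply: basis_crossing.
  - apply/setP => u; rewrite !inE; case: (boolP (u \in E1)) => //= _; rewrite andbT.
    by rewrite orNb.
  - rewrite -setI_eq0; apply/eqP/setP => u; rewrite in_setI in_setD in_set0.
    by case: (u \in X1); rewrite ?andbF.
  rewrite ltnNge; apply: contra nsep1 => le.
  apply: separator_sub sE _ _; first exact: subsetDl.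
  by rewrite setDDr setDv set0U (setIidPr X1E).
case/setIP: aB => aB1 /setDP[aE aX1]; case/setDP: cB => cX1 cB1.
have := separators_noncrossing (c := c) (e := e) sE B1E (subset_trans B2E E2E)
  i1 i2 aB1 _ cE la0 bB2 _ eE mb.
move: aX1 cX1; rewrite !inE aE /= => aX1 /andP[cE1 bce].
rewrite cE1 cB1 eB2 bce (negbTE aX1) /=.
have -> : e \notin E1 by have := subsetP E2E _ eE2; rewrite inE.
move=> /(_ isT isT) /andP[ea ab].
by move: ea ab bze ze; clear; lia.
Qed.

Lemma irreducible_onP : reflect (forall S, separator A S -> S = set0 \/ S = setT)
  (irreducible_on setT (decperm A)).
Proof.
apply: (iffP idP) => [irr S sS|conn].
  have [->|S0] := eqVneq S set0; [by left|right].
  by apply/eqP; apply: contraTT irr => ST; apply: separator_reducible sS S0 ST.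
apply/forallP => J; apply/implyP => /and3P[iJ J0 sJ].
have [J0'|->//] := conn J (stable_separator iJ sJ).
by rewrite J0' eqxx in J0.
Qed.

End Connectedness.

(** * Noncrossing partitions *)

Section NoncrossingPartitions.
Variable n : nat.
Implicit Types (P : {set {set 'I_n}}) (A B C J : {set 'I_n}).
Implicit Types (h : {ffun 'I_n -> option 'I_n}).

Lemma partition_setTP P : reflect
  [/\ set0 \notin P, forall x, exists2 B, B \in P & x \in B &
      forall A B x, A \in P -> B \in P -> x \in A -> x \in B -> A = B]
  (partition P [set: 'I_n]).
Proof.
apply: (iffP and3P) => [[/eqP cov tr P0]|[P0 cov tr]].
  split=> // [x|A B x AP BP xA xB].
    by have /bigcupP[B BP xB] : x \in cover P; rewrite ?cov ?inE //; exists B.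
  by rewrite -(def_pblock tr AP xA) (def_pblock tr BP xB).
split=> //.
  rewrite -subTset; apply/subsetP => x _; have [B BP xB] := cov x.
  by apply/bigcupP; exists B.
apply/trivIsetP => A B AP BP; apply: contraR; rewrite -setI_eq0 => /set0Pn[x].
by rewrite inE => /andP[xA xB]; apply/eqP; apply: tr xA xB.
Qed.

(** A rotation of the cyclic order at most exchanges the roles of the two blocks, so every crossing
    can be put in increasing order. *)
Lemma noncrossingP P : reflect
  (forall A B a b c d, A \in P -> B \in P -> A != B -> a \in A -> b \in B -> c \in A ->
     d \in B -> (a < b)%N -> (b < c)%N -> (c < d)%N -> False)
  (noncrossing P).
Proof.
apply: (iffP idP) => [nc A B a b c d AP BP AB aA bB cA dB ab bc cd|nc].
  move/forall_inP/(_ _ AP)/forall_inP/(_ _ BP)/implyP/(_ AB)/negP: nc; apply.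
  apply/exists_inP; exists a => //; apply/exists_inP; exists b => //.
  apply/exists_inP; exists c => //; apply/exists_inP; exists d => //.
  by rewrite /cyclically_ordered /= ab bc cd.
apply/forall_inP => A AP; apply/forall_inP => B BP; apply/implyP => AB.
apply/negP => /exists_inP[a aA /exists_inP[b bB /exists_inP[c cA /exists_inP[d dB]]]].
have BA : B != A by rewrite eq_sym.
rewrite /cyclically_ordered /= !andbT orbF => /or4P[] /and3P[].
- exact: (nc A B a b c d).
- exact: (nc B A b c d a).
- exact: (nc A B c d a b).
- exact: (nc B A d a b c).
Qed.

Definition compatible P h := [forall B in P, stable h B && irreducible_on B h].

Lemma compatibleP P h : reflect
  (forall B, B \in P -> stable h B /\ irreducible_on B h) (compatible P h).
Proof.
by apply: (iffP forall_inP) => H B /H; [move/andP|move/andP].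
Qed.

Lemma irreducible_onE B h J : irreducible_on B h -> interval_of B J -> J != set0 ->
  stable h J -> J = B.
Proof. by move=> /forallP/(_ J)/implyP irr iJ J0 sJ; apply/eqP/irr/and3P. Qed.

Lemma stable_inv h J x : h \in decperms n -> stable h J -> underlying h x \in J -> x \in J.
Proof.
move=> hD /stableP sJ; have hI := underlying_inj hD.
have e : underlying h @: J = J.
  apply/eqP; rewrite eqEcard card_imset // leqnn andbT.
  by apply/subsetP => _ /imsetP[y yJ ->]; apply: sJ.
by rewrite -{1}e mem_imset.
Qed.

(** No element of [B :\: J] lies between two elements of [J], so the two pieces do not cross; with
    the other blocks they inherit this from [B]. *)
Lemma split_block_NC P B J : P \in NC n -> B \in P -> interval_of B J ->
  J != set0 -> J != B -> J |: ((B :\: J) |: P :\ B) \in NC n /\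
  (#|P| < #|J |: ((B :\: J) |: P :\ B)|)%N.
Proof.
rewrite inE => /andP[/partition_setTP[P0 cov tr] /noncrossingP nc] BP.
move=> /interval_ofP[JB cJ] J0 JnB.
have BJ0 : B :\: J != set0.
  by apply: contra JnB; rewrite setD_eq0 eqEsubset JB => ->.
have notin A : A \subset B -> A != set0 -> A \in P -> A = B.
  move=> AB /set0Pn[x xA] AP; by apply: (tr _ _ x) => //; apply: (subsetP AB).
have JBJ : J != B :\: J.
  have /set0Pn[x xJ] := J0; apply/eqP => /setP/(_ x); rewrite !inE xJ.
  by [].
have blk A : A \in J |: ((B :\: J) |: P :\ B) ->
    [\/ A = J, A = B :\: J | A \in P /\ A != B].
  rewrite !inE => /or3P[/eqP|/eqP|/andP[]]; first by constructor 1.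
    by constructor 2.
  by constructor 3.
split.
  rewrite inE; apply/andP; split.
    apply/partition_setTP; split.
    - rewrite !inE !negb_or ![set0 == _]eq_sym J0 BJ0 negb_and.
      by rewrite P0 orbT.
    - move=> x; have [C CP xC] := cov x; have [CB|CnB] := eqVneq C B; last first.
        by exists C => //; rewrite !inE CnB CP !orbT.
      rewrite CB in xC; have [xJ|xJ] := boolP (x \in J).
        by exists J; rewrite // !inE eqxx.
      by exists (B :\: J); rewrite !inE ?xJ // eqxx orbT.
    - have dis C x : C \in P -> C != B -> x \in C -> x \notin B.
        by move=> CP CB xC; apply: contra CB => xB; apply/eqP; apply: tr CP BP xC xB.
      move=> A C x /blk[->|->|[AP AB]] /blk[->|->|[CP CB]] //.
      + by rewrite !inE => ->.
      + by move=> /(subsetP JB) xB /(dis _ _ CP CB); rewrite xB.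
      + by rewrite !inE => /andP[/negbTE ->].
      + by rewrite !inE => /andP[_ xB] /(dis _ _ CP CB); rewrite xB.
      + by move=> /(dis _ _ AP AB) xB /(subsetP JB); rewrite (negbTE xB).
      + by move=> /(dis _ _ AP AB) xB; rewrite !inE (negbTE xB) andbF.
      + by move=> xA xC; apply: tr AP CP xA xC.
  apply/noncrossingP => A C a b c d Ab Cb AC aA bC cA dC ab bc cd.
  (* [par] sends a block of the refined partition to the block of [P] containing it. *)
  pose par X := if (X == J) || (X == B :\: J) then B else X.
  have parJ : par J = B by rewrite /par eqxx.
  have parBJ : par (B :\: J) = B by rewrite /par eqxx orbT.
  have parX X : X \in P -> X != B -> par X = X.
    move=> XP XB; rewrite /par; case: ifP => // /orP[] /eqP e;
      by move: XB; rewrite (notin X) ?eqxx // e // subsetDl.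
  have parP X : X \in J |: ((B :\: J) |: P :\ B) -> par X \in P.
    by move=> /blk[->|->|[XP XB]]; rewrite ?parJ ?parBJ ?parX.
  have subP X : X \in J |: ((B :\: J) |: P :\ B) -> X \subset par X.
    by move=> /blk[->|->|[XP XB]]; rewrite ?parJ ?parBJ ?parX ?subsetDl.
  have [e|ne] := eqVneq (par A) (par C); last first.
    exact: (nc _ _ a b c d (parP _ Ab) (parP _ Cb) ne (subsetP (subP _ Ab) _ aA)
      (subsetP (subP _ Cb) _ bC) (subsetP (subP _ Ab) _ cA) (subsetP (subP _ Cb) _ dC)).
  have dichotomy : (A = J /\ C = B :\: J) \/ (A = B :\: J /\ C = J).
    move: e AC; case: (blk _ Ab) => [->|->|[AP AB]];
      case: (blk _ Cb) => [->|->|[CP CB]]; rewrite ?parJ ?parBJ ?parX ?eqxx //; auto.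
    - by move=> e; rewrite -e eqxx in CB.
    - by move=> e; rewrite -e eqxx in CB.
    - by move=> e; rewrite e eqxx in AB.
    - by move=> e; rewrite e eqxx in AB.
    - by move=> ->; rewrite eqxx.
  case: dichotomy => -[AE CE]; rewrite AE CE in aA bC cA dC.
    move: bC; rewrite inE => /andP[/negP bJ bB]; apply: bJ; apply: (cJ a b c) => //.
    by rewrite ab.
  move: cA; rewrite inE => /andP[/negP cJ' cB]; apply: cJ'; apply: (cJ b c d) => //.
  by rewrite bc.
rewrite !cardsU1 (cardsD1 B P) BP !inE negb_or JBJ.
have -> : (J \in P) = false by apply/negbTE; apply: contra JnB => /(notin J JB J0) ->.
have -> : (B :\: J \in P) = false.
  apply/negbTE/negP => /(notin _ (subsetDl _ _) BJ0) e.
  have /set0Pn[x xJ] := J0; have := subsetP JB x xJ.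
  by rewrite -e inE xJ.
by rewrite !andbF.
Qed.

(** Take a noncrossing partition into stable blocks with the most blocks. A stable relative interval
    of a block could be split off, because its complement in the block is stable too. *)
Lemma compatible_exists h : (0 < n)%N -> h \in decperms n ->
  exists2 P, P \in NC n & compatible P h.
Proof.
move=> n0 hD; pose Q P := (P \in NC n) && [forall B in P, stable h B].
have Q0 : Q [set setT].
  rewrite /Q top_partition_NC //; apply/forall_inP => B /set1P ->.
  by apply/stableP => x _; rewrite inE.
case: (arg_maxnP (P := Q) (fun P => #|P|) Q0) => P /andP[PN /forall_inP sP] maxP.
exists P => //; apply/compatibleP => B BP; split; first exact: sP.
apply/forallP => J; apply/implyP => /and3P[iJ J0 sJ]; apply: contraT => JB.
have [P'N] := split_block_NC PN BP iJ J0 JB; rewrite ltnNge => /negP[]; apply: maxP.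
rewrite /Q P'N; apply/forall_inP => C; rewrite !inE => /or3P[/eqP ->//|/eqP ->|/andP[_ /sP//]].
apply/stableP => x; rewrite !inE => /andP[xJ xB].
have /stableP/(_ x xB) -> := sP _ BP; rewrite andbT.
by apply: contra xJ; apply: stable_inv.
Qed.

(* [J] is the first gap that the block [C0] of [min B] leaves in [B]; since
   blocks do not cross, those meeting [J] do not leave it inside [B], so that
   [J] would be stable. *)
Lemma irreducible_block P B C h x : P \in NC n -> (forall A, A \in P -> stable h A) ->
  stable h B -> irreducible_on B h -> C \in P -> x \in B -> x \in C -> B \subset C.
Proof.
rewrite inE => /andP[/partition_setTP[P0 cov tr] /noncrossingP nc] sP.
move=> /stableP sB irr CP xB xC.
case: (arg_minnP (i0 := x) (P := fun y => y \in B) (@nat_of_ord n) xB) => a aB amin.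
have [C0 C0P aC0] := cov a.
suff BC0 : B \subset C0 by rewrite (tr C C0 x) // (subsetP BC0).
apply: contraT => /subsetPn[y0 y0B y0C].
have y0P : (y0 \in B) && (y0 \notin C0) by rewrite y0B.
case: (arg_minnP (i0 := y0) (P := fun y => (y \in B) && (y \notin C0)) (@nat_of_ord n) y0P)
  => y /andP[yB yC] ymin.
have ay : (a < y)%N.
  by rewrite ltn_neqAle amin // andbT; apply: contraNneq yC => /val_inj <-.
pose J := [set u in B | (y <= u)%N && [forall z in C0, (y < z)%N ==> (u < z)%N]].
have JP (u : 'I_n) : reflect ([/\ u \in B, (y <= u)%N &
    forall z : 'I_n, z \in C0 -> (y < z)%N -> (u < z)%N]) (u \in J).
  rewrite inE; apply: (iffP and3P) => -[uB yu H]; split=> //.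
    by move=> z zE; apply/implyP; move/forall_inP: H; apply.
  by apply/forall_inP => z zE; apply/implyP; apply: H.
have JN (u : 'I_n) : u \in B -> u \notin J -> (y <= u)%N ->
    exists2 z, z \in C0 & (y < z <= u)%N.
  rewrite inE => -> + yu; rewrite yu /= negb_forall_in => /exists_inP[z zE].
  by rewrite negb_imply -leqNgt => yzx; exists z.
have JC u : u \in J -> u \notin C0.
  move=> /JP[_ yu H]; apply/negP => uC.
  have : (u < u)%N.
    by apply: H => //; rewrite ltn_neqAle yu andbT; apply: contraNneq yC => /val_inj ->.
  by rewrite ltnn.
suff JB : J = B by have := JC a; rewrite JB aB aC0 => /(_ isT).
apply: (irreducible_onE irr).
- apply/interval_ofP; split; first by apply/subsetP => u /JP[].
  move=> u v w /JP[_ yu _] vB /JP[_ _ Hw] /andP[uv vw]; apply/JP; split=> //.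
    by apply: leq_trans yu (ltnW uv).
  by move=> z zE yz; apply: ltn_trans vw (Hw z zE yz).
- by apply/set0Pn; exists y; apply/JP; split.
apply/stableP => u uJ; have uC := JC _ uJ; have /JP[uB yu Hu] := uJ.
have [C1 C1P uC1] := cov u; have /stableP/(_ _ uC1) puC1 := sP _ C1P.
have C10 : C0 != C1 by apply: contraNneq uC => ->.
have puC0 : underlying h u \notin C0.
  by apply: contra C10 => puC0; apply/eqP; apply: tr C0P C1P puC0 puC1.
apply: contraT => npJ; exfalso.
have puB := sB _ uB.
have [z zC /andP[yz zpu]] := JN _ puB npJ (ymin _ (introT andP (conj puB puC0))).
apply: (nc C0 C1 a u z (underlying h u)) => //.
- exact: leq_trans ay yu.
- exact: Hu.
- by rewrite ltn_neqAle zpu andbT; apply: contraNneq puC0 => /val_inj <-.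
Qed.

Lemma compatible_uniq P P' h : P \in NC n -> P' \in NC n ->
  compatible P h -> compatible P' h -> P = P'.
Proof.
have sub Q Q' : Q \in NC n -> Q' \in NC n -> compatible Q h -> compatible Q' h -> Q \subset Q'.
  move=> QN QN' /compatibleP cQ /compatibleP cQ'.
  have := QN; rewrite inE => /andP[/partition_setTP[Q0 _ _] _].
  have := QN'; rewrite inE => /andP[/partition_setTP[_ cov' tr'] _].
  apply/subsetP => B BQ; have /set0Pn[x xB] : B != set0 by apply: contraNneq Q0 => <-.
  have [C CQ' xC] := cov' x.
  suff -> : B = C by [].
  have [sB iB] := cQ _ BQ; have [sC iC] := cQ' _ CQ'.
  apply/eqP; rewrite eqEsubset; apply/andP; split.
    by apply: (irreducible_block QN' _ sB iB CQ' xB xC) => A /cQ'[].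
  by apply: (irreducible_block QN _ sC iC BQ xC xB) => A /cQ[].
by move=> PN PN' cP cP'; apply/eqP; rewrite eqEsubset !sub.
Qed.

End NoncrossingPartitions.

Definition irreducible_decperms k : {set {ffun 'I_k -> option 'I_k}} :=
  [set h in decperms k | irreducible_on setT h].

(** * Decorated permutations as families over the blocks *)

Section Blocks.
Variable n : nat.
Implicit Types (P : {set {set 'I_n}}) (A B C J : {set 'I_n}).
Implicit Types (g h : {ffun 'I_n -> option 'I_n}).

Lemma underlying_eq g h x : g x = h x -> underlying g x = underlying h x.
Proof. by rewrite /underlying => ->. Qed.

Lemma eq_stable J g h : {in J, g =1 h} -> stable g J = stable h J.
Proof. move=> e; apply: eq_forallb => x; case: (boolP (x \in J)) => //= xJ.
by rewrite (underlying_eq (e x xJ)). Qed.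

Lemma eq_irreducible_on B g h : {in B, g =1 h} -> irreducible_on B g = irreducible_on B h.
Proof.
move=> e; apply: eq_forallb => J; case: (boolP (interval_of B J)) => //= /interval_ofP[JB _].
by rewrite (@eq_stable J g h) // => x xJ; apply: e; apply: (subsetP JB).
Qed.

(** The value [None] outside [B] makes an element determined by its restriction to [B]. *)
Definition block_decperms B : {set {ffun 'I_n -> option 'I_n}} :=
  [set h in decperms n | [&& [forall x, (x \notin B) ==> (h x == None)],
     stable h B & irreducible_on B h]].

Lemma block_decpermsP B h : reflect
  [/\ h \in decperms n, forall x, x \notin B -> h x = None, stable h B & irreducible_on B h]
  (h \in block_decperms B).
Proof.
rewrite [h \in block_decperms B]in_set; apply: (iffP and4P) => -[hD hN sB iB]; split=> //.
  by move=> x xB; apply/eqP; move/forallP/(_ x)/implyP: hN; apply.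
by apply/forallP => x; apply/implyP => xB; rewrite hN.
Qed.

Definition no_decperm : {ffun 'I_n -> option 'I_n} := [ffun=> None].

Definition glue P (f : {ffun {set 'I_n} -> {ffun 'I_n -> option 'I_n}}) :
  {ffun 'I_n -> option 'I_n} := [ffun x => f (pblock P x) x].

Lemma glueE P f B x : partition P setT -> B \in P -> x \in B -> glue P f x = f B x.
Proof. by case/and3P => _ tr _ BP xB; rewrite ffunE (def_pblock tr BP xB). Qed.

(** By restriction and gluing, a compatible permutation amounts to an independent choice of an
    irreducible one on each block. *)
Lemma card_compatible P : partition P setT ->
  #|[set h in decperms n | compatible P h]| = (\prod_(B in P) #|block_decperms B|)%N.
Proof.
move=> pP; have /partition_setTP[P0 cov tr] := pP.
(* Off [P] a family takes the default value [no_decperm], which makes [glue P] injective on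
   [Fam]. *)
pose Fam := [set f in pfamily no_decperm (mem P) (fun B => mem (block_decperms B))].
have FamP (f : {ffun {set 'I_n} -> {ffun 'I_n -> option 'I_n}}) : reflect
    ((forall B, B \notin P -> f B = no_decperm) /\
     forall B, B \in P -> f B \in block_decperms B) (f \in Fam).
  rewrite inE; apply: (iffP pfamilyP) => -[H1 H2]; split.
  - by move=> B BP; apply/eqP; apply: contraNT BP => fB; apply: (subsetP H1).
  - by move=> B BP; apply: H2.
  - by apply/subsetP => B; rewrite inE; apply: contraR => /H1 ->.
  - by move=> B BP; apply: H2.
transitivity #|Fam|; last first.
  rewrite cardsE card_pfamily foldrE big_map big_enum.
  by [].
suff -> : [set h in decperms n | compatible P h] = glue P @: Fam.
  rewrite card_in_imset // => f g /FamP[f0 f1] /FamP[g0 g1] e.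
  apply/ffunP => B; have [BP|BP] := boolP (B \in P); last by rewrite f0 ?g0.
  apply/ffunP => x; have [xB|xB] := boolP (x \in B); last first.
    have /block_decpermsP[_ -> // _ _] := f1 _ BP.
    by have /block_decpermsP[_ -> // _ _] := g1 _ BP.
  by rewrite -(glueE f pP BP xB) e (glueE g pP BP xB).
apply/setP => h; apply/idP/imsetP => [|[f /FamP[f0 f1] ->]].
  rewrite inE => /andP[hD /compatibleP cP].
  pose restr B : {ffun 'I_n -> option 'I_n} := [ffun x => if x \in B then h x else None].
  have restrE B : {in B, restr B =1 h} by move=> x xB; rewrite ffunE xB.
  exists [ffun B => if B \in P then restr B else no_decperm].
    apply/FamP; split=> [B /negbTE BP|B BP]; rewrite ffunE BP //.
    have [sB iB] := cP _ BP; apply/block_decpermsP; split.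
    - rewrite inE; apply/injectiveP => x y; rewrite -!/(underlying _ _).
      have out z : z \notin B -> underlying (restr B) z = z.
        by move=> zB; rewrite /underlying ffunE (negbTE zB).
      have inn z : z \in B -> underlying (restr B) z = underlying h z.
        by move=> zB; apply: underlying_eq; apply: restrE.
      have /stableP sB' := sB.
      have [xB|xB] := boolP (x \in B); have [yB|yB] := boolP (y \in B).
      + by rewrite !inn //; apply: underlying_inj.
      + by rewrite (inn x) // (out y) // => e; rewrite -e sB' in yB.
      + by rewrite (inn y) // (out x) // => e; rewrite e sB' in xB.
      + by rewrite !out.
    - by move=> x xB; rewrite ffunE (negbTE xB).
    - by rewrite (eq_stable (@restrE B)).
    - by rewrite (eq_irreducible_on (@restrE B)).
  apply/ffunP => x; have [B BP xB] := cov x.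
  by rewrite (glueE _ pP BP xB) ffunE BP restrE.
have gE B : B \in P -> {in B, glue P f =1 f B} by move=> BP x xB; apply: glueE.
rewrite inE; apply/andP; split; last first.
  apply/compatibleP => B BP; have /block_decpermsP[_ _ sB iB] := f1 _ BP.
  by rewrite (eq_stable (gE _ BP)) (eq_irreducible_on (gE _ BP)).
rewrite inE; apply/injectiveP => x y; rewrite -!/(underlying _ _).
have [B BP xB] := cov x; have [C CP yC] := cov y.
rewrite (underlying_eq (gE _ BP x xB)) (underlying_eq (gE _ CP y yC)) => e.
have /block_decpermsP[DB _ /stableP sB _] := f1 _ BP.
have /block_decpermsP[_ _ /stableP sC _] := f1 _ CP.
have BC : B = C by apply: (tr _ _ (underlying (f B) x)) => //; rewrite ?sB // e sC.
by rewrite -BC in e; apply: underlying_inj e.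
Qed.

End Blocks.

(** * Relabelling along an increasing map *)

Section Relabelling.
Variables (n k : nat) (f : 'I_k -> 'I_n).
Hypothesis fi : {homo f : i j / (i < j)%N}.
Let finj : injective f := incr_inj fi.
Let B := f @: setT.

Definition relabel (g : {ffun 'I_k -> option 'I_k}) : {ffun 'I_n -> option 'I_n} :=
  [ffun x => if [pick i | f i == x] is Some i then omap f (g i) else None].

Lemma relabel_in g i : relabel g (f i) = omap f (g i).
Proof.
rewrite ffunE; case: pickP => [j /eqP/finj ->//|/(_ i)].
by rewrite eqxx.
Qed.

Lemma relabel_out g x : x \notin B -> relabel g x = None.
Proof.
move=> xB; rewrite ffunE; case: pickP => // j /eqP fj.
by move: xB; rewrite -fj imset_f.
Qed.

Lemma underlying_relabel g i : underlying (relabel g) (f i) = f (underlying g i).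
Proof. by rewrite /underlying relabel_in; case: (g i). Qed.

Lemma incr_mono i j : (f i < f j)%N = (i < j)%N.
Proof.
apply/idP/idP => [|/fi//]; rewrite !ltnNge; apply: contra.
by rewrite leq_eqVlt => /predU1P[/val_inj ->//|/fi/ltnW].
Qed.

Lemma stable_relabel g (J : {set 'I_k}) : stable (relabel g) (f @: J) = stable g J.
Proof.
apply/stableP/stableP => sJ x => [xJ|/imsetP[i iJ ->]].
  by have := sJ (f x); rewrite underlying_relabel !mem_imset // => ->.
by rewrite underlying_relabel mem_imset // sJ.
Qed.

Lemma interval_relabel (J : {set 'I_k}) : interval_of B (f @: J) = interval_of setT J.
Proof.
apply/interval_ofP/interval_ofP => -[JB cJ]; split; rewrite ?subsetT ?imsetS ?subsetT //.
  move=> x y z xJ _ zJ xyz; rewrite -(mem_imset J y finj).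
  by apply: (cJ (f x) _ (f z)); rewrite ?imset_f ?incr_mono.
move=> _ _ _ /imsetP[x xJ ->] /imsetP[y _ ->] /imsetP[z zJ ->]; rewrite !incr_mono => xyz.
by apply: imset_f; apply: cJ xJ _ zJ xyz; rewrite inE.
Qed.

Lemma irreducible_relabel g : irreducible_on B (relabel g) = irreducible_on setT g.
Proof.
have im0 (J : {set 'I_k}) : (f @: J == set0) = (J == set0) by rewrite imset_eq0.
apply/forallP/forallP => H J; apply/implyP => /and3P[iJ J0 sJ].
  have /implyP := H (f @: J); rewrite interval_relabel iJ im0 J0 stable_relabel sJ.
  by move=> /(_ isT)/eqP/(imset_inj finj) ->.
have JE : J = f @: (f @^-1: J).
  have /interval_ofP[/subsetP JB _] := iJ.
  apply/setP => x; apply/idP/imsetP => [xJ|[i + ->]]; last by rewrite inE.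
  by have /imsetP[i _ xi] := JB x xJ; exists i; rewrite ?inE -?xi.
rewrite JE in iJ J0 sJ *; rewrite interval_relabel in iJ; rewrite im0 in J0.
rewrite stable_relabel in sJ; have /implyP := H (f @^-1: J); rewrite iJ J0 sJ.
by move=> /(_ isT)/eqP ->.
Qed.

Lemma relabel_inj : injective relabel.
Proof.
move=> g h e; apply/ffunP => i; have := relabel_in g i; rewrite e relabel_in.
by case: (g i) (h i) => [x|] [y|] //= [/finj ->].
Qed.

Lemma relabel_decperms g : (relabel g \in decperms n) = (g \in decperms k).
Proof.
rewrite !inE; apply/injectiveP/injectiveP => gi x y; rewrite -!/(underlying _ _).
  move/(congr1 f); rewrite -!underlying_relabel => /gi.
  exact: finj.
have out z : z \notin B -> underlying (relabel g) z = z.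
  by move=> zB; rewrite /underlying relabel_out.
have inB i : f i \in B by apply: imset_f.
have [/imsetP[i _ ->]|xB] := boolP (x \in B); have [/imsetP[j _ ->]|yB] := boolP (y \in B).
- by rewrite !underlying_relabel => /finj/gi ->.
- by rewrite underlying_relabel (out y) // => e; rewrite -e inB in yB.
- by rewrite underlying_relabel (out x) // => e; rewrite e inB in xB.
- by rewrite !out.
Qed.

Lemma block_decperms_relabel : block_decperms B = relabel @: irreducible_decperms k.
Proof.
apply/setP => h; apply/block_decpermsP/imsetP => [[hD hN sB iB]|[g + ->]].
  pose g := [ffun i => if h (f i) is Some y then [pick j | f j == y] else None].
  have gE : relabel g = h.
    apply/ffunP => x; have [/imsetP[i _ ->]|xB] := boolP (x \in B); last first.
      by rewrite relabel_out ?hN.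
    rewrite relabel_in ffunE; have /stableP/(_ (f i)) := sB; rewrite imset_f // => /(_ isT).
    rewrite /underlying; case: (h (f i)) => [y|] //= /imsetP[j _ ->].
    by case: pickP => [l /eqP /= e|/(_ j)]; rewrite ?eqxx // e.
  exists g => //; rewrite inE -relabel_decperms gE hD -irreducible_relabel gE.
  exact: iB.
rewrite inE => /andP[gD ig]; split.
- by rewrite relabel_decperms.
- exact: relabel_out.
- by rewrite stable_relabel; apply/stableP => x _; rewrite inE.
- by rewrite irreducible_relabel.
Qed.

End Relabelling.

Lemma card_block_decperms n (B : {set 'I_n}) :
  #|block_decperms B| = #|irreducible_decperms #|B| |.
Proof.
have [f fi fB] := incr_exists (erefl #|B|).
by rewrite -[in LHS]fB block_decperms_relabel // card_imset //; apply: relabel_inj.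
Qed.

(** Pairs of a decorated permutation and a compatible noncrossing partition are counted twice: each
    permutation has exactly one such partition, and for a fixed partition the permutations are
    counted block by block. *)
Lemma card_decperms_NC n : (0 < n)%N ->
  #|decperms n| = (\sum_(P in NC n) \prod_(B in P) #|irreducible_decperms #|B| |)%N.
Proof.
move=> n0; under eq_bigr => P.
  rewrite inE => /andP[pP _].
  under eq_bigr => B _ do rewrite -card_block_decperms.
  rewrite -card_compatible // -sum1_card; over.
rewrite (exchange_big_dep (mem (decperms n))) /=; last first.
  by move=> P h _; rewrite inE => /andP[].
rewrite -sum1_card; apply: eq_bigr => h hD.
have [P PN cP] := compatible_exists n0 hD.
rewrite (bigD1 P) /=; last by rewrite PN inE hD.
rewrite big1 // => Q /andP[/andP[QN]]; rewrite inE => /andP[_ cQ].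
by rewrite (compatible_uniq QN PN cQ cP) eqxx.
Qed.

(** A decorated permutation is a set of nonloops with a permutation supported on it; the sets of
    size [k] contribute a binomial coefficient times a factorial, that is [n ^_ k]. *)
Lemma card_decperms n : #|decperms n| = (\sum_(k < n.+1) n ^_ k)%N.
Proof.
pose D := [set u : {set 'I_n} * {perm 'I_n} | perm_on u.1 u.2].
pose phi (u : {set 'I_n} * {perm 'I_n}) : {ffun 'I_n -> option 'I_n} :=
  [ffun x => if x \in u.1 then Some (u.2 x) else None].
have -> : decperms n = phi @: D.
  apply/setP => h; apply/idP/imsetP => [hD|[[S s] + ->]].
    have hI := underlying_inj hD.
    exists ([set x | h x != None], perm hI).
      rewrite inE; apply/subsetP => x; rewrite !inE /= permE.
      by apply: contra => /eqP e; rewrite /underlying e.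
    apply/ffunP => x; rewrite ffunE inE /= permE /underlying.
    by case: (h x).
  rewrite !inE /= => sS; apply/injectiveP => x y; rewrite !ffunE /=.
  have sE z : odflt z (if z \in S then Some (s z) else None) = s z.
    by case: (boolP (z \in S)) => //= zS; rewrite (out_perm sS).
  by rewrite !sE; apply: perm_inj.
rewrite card_in_imset; last first.
  move=> [S s] [S' s']; rewrite !inE /= => sS sS' /ffunP e.
  have SS : S = S'.
    apply/setP => x; have := e x; rewrite !ffunE /=.
    by case: (x \in S); case: (x \in S').
  rewrite -SS in sS' e *; congr pair; apply/permP => x; have := e x; rewrite !ffunE /=.
  by case: (boolP (x \in S)) => [_ []//|xS _]; rewrite !(out_perm _ xS).
rewrite -sum1_card.
rewrite (eq_bigl (fun u : {set 'I_n} * {perm 'I_n} => true && perm_on u.1 u.2)); last first.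
  by move=> u; rewrite inE.
rewrite -(pair_big_dep xpredT (fun S s => perm_on S s) (fun _ _ => 1%N)) /=.
rewrite (partition_big (fun S : {set 'I_n} => inord #|S| : 'I_n.+1) xpredT) //=.
apply: eq_bigr => k _.
rewrite (eq_bigr (fun=> k`!)); last first.
  move=> S /eqP <-; have cS : (#|S| < n.+1)%N.
    by rewrite ltnS -[X in (_ <= X)%N](card_ord n) max_card.
  by rewrite sum1_card inordK // -card_perm; apply: eq_card => s.
rewrite sum_nat_const -bin_ffact; congr (_ * _)%N.
have := card_draws 'I_n k; rewrite card_ord => <-; rewrite cardsE; apply: eq_card => S.
rewrite -[LHS]/(inord #|S| == k) -[RHS]/(#|S| == k) -val_eqE /= inordK //.
by rewrite ltnS -[X in (_ <= X)%N](card_ord n) max_card.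
Qed.

(** * Counting positroids *)

Section ColumnMatroids.
Variables (F : fieldType) (d n : nat) (A : 'M[F]_(d, n)).
Implicit Types (S X Y : {set 'I_n}).

Lemma mem_column_matroid X : (X \in indep (column_matroid A)) = colindep A X.
Proof. by rewrite inE. Qed.

Lemma restriction_axioms S :
  matroid_axioms S [set X : {set 'I_n} | X \subset S & colindep A X].
Proof.
have /and4P[I0 _ IS IX] := column_indep_matroid A.
apply/and4P; split.
- by rewrite inE sub0set colindep0.
- by apply/forall_inP => X; rewrite inE => /andP[].
- apply/forall_inP => X; rewrite inE => /andP[XS iX]; apply/forallP => Y; apply/implyP => YX.
  by rewrite inE (subset_trans YX XS) (colindepS YX iX).
apply/forall_inP => X; rewrite inE => /andP[XS iX]; apply/forall_inP => Y.
rewrite inE => /andP[YS iY]; apply/implyP => XY.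
have /forall_inP/(_ X) := IX; rewrite inE => /(_ iX)/forall_inP/(_ Y).
rewrite inE => /(_ iY)/implyP/(_ XY)/exists_inP[y yYX iyX].
apply/exists_inP; exists y => //.
have {}iyX : colindep A (y |: X) by move: iyX; rewrite inE.
rewrite inE subUset sub1set XS iyX !andbT.
by move: yYX; rewrite inE => /andP[_ /(subsetP YS)].
Qed.

(** A separator splits the matroid into its two restrictions. Conversely, bases of the two summands
    have an independent union, so the ranks add up. *)
Lemma connected_column_matroidP :
  connected_matroid (column_matroid A) <->
  (forall S, separator A S -> S = set0 \/ S = setT).
Proof.
split=> [conn S sS|H [E1 [E2 [M1 [M2 [E10 E20 [dE EE IE]]]]]]].
  have [->|S0] := eqVneq S set0; [by left|right]; apply/eqP/negP => ST.
  apply: conn; exists S, (~: S).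
  exists (Matroid (restriction_axioms S)), (Matroid (restriction_axioms (~: S))).
  split=> //; first by apply: contra_notN ST => /eqP e; rewrite -(setCK S) e setC0.
  split; first by rewrite -setI_eq0 setICr.
    by rewrite setUCr.
  apply/setP => X; rewrite mem_column_matroid; apply/idP/imset2P => [iX|[X1 X2]].
    exists (X :&: S) (X :\: S); rewrite ?inE ?subsetIr ?setID //=.
      by apply: colindepS iX; apply: subsetIl.
    by rewrite setDE subsetIr; apply: colindepS iX; apply: subsetIl.
  rewrite !inE => /andP[X1S i1] /andP[X2S i2] ->.
  exact: colindep_separator sS X1S X2S i1 i2.
have E2C : E2 = ~: E1.
  apply/setP => x; have /setP/(_ x) := EE; rewrite !inE.
  have := dE; rewrite -setI_eq0 => /eqP/setP/(_ x); rewrite !inE.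
  by case: (x \in E1); case: (x \in E2).
have subM (E : {set 'I_n}) (M : matroid E) X : X \in indep M -> X \subset E.
  by case: M => I /= /and4P[_ /forall_inP H' _ _]; apply: H'.
have part E E' (M : matroid E) (M' : matroid E') X X1 X2 : E' = ~: E -> X1 \in indep M ->
    X2 \in indep M' -> X = X1 :|: X2 -> X \subset E -> X = X1.
  move=> EC X1M X2M ->; rewrite subUset => /andP[_ X2E].
  suff -> : X2 = set0 by rewrite setU0.
  apply/eqP; rewrite -subset0 -(setICr E) -EC subsetI X2E.
  exact: (subM _ M').
have sep : separator A E1.
  have [B1 [_ B1E i1 s1]] := colindep_ext (sub0set E1) (colindep0 A).
  have [B2 [_ B2E i2 s2]] := colindep_ext (sub0set (~: E1)) (colindep0 A).
  have B1M : B1 \in indep M1.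
    have : B1 \in indep (column_matroid A) by rewrite mem_column_matroid.
    rewrite IE => /imset2P[X1 X2 X1M X2M e].
    by rewrite (part _ _ M1 M2 _ _ _ E2C X1M X2M e B1E).
  have B2M : B2 \in indep M2.
    have : B2 \in indep (column_matroid A) by rewrite mem_column_matroid.
    rewrite IE => /imset2P[X1 X2 X1M X2M e]; rewrite setUC in e.
    rewrite -E2C in B2E; have E1C : E1 = ~: E2 by rewrite E2C setCK.
    by rewrite (part _ _ M2 M1 _ _ _ E1C X2M X1M e B2E).
  have iU : colindep A (B1 :|: B2).
    by rewrite -mem_column_matroid IE; apply: imset2_f.
  rewrite /separator eqn_leq -{2}(setUCr E1) dim_colspanU_le andbT -s1 -s2.
  move: i1 i2 iU; rewrite !colindep_dim => /eqP -> /eqP -> /eqP iU.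
  apply: leq_trans (dimvS (colspanS A (subsetT (B1 :|: B2)))); rewrite iU.
  rewrite cardsU (_ : B1 :&: B2 = set0) ?cards0 ?subn0 //.
  by apply/eqP; rewrite -subset0 -(setICr E1) setISS.
have [E0|ET] := H _ sep; first by rewrite E0 eqxx in E10.
by rewrite E2C ET setCT eqxx in E20.
Qed.

End ColumnMatroids.

Lemma eq_column_matroid (F : fieldType) n d1 d2 (A1 : 'M[F]_(d1, n)) (A2 : 'M[F]_(d2, n)) :
  colindep A1 =1 colindep A2 <-> column_matroid A1 = column_matroid A2.
Proof.
split=> [e|e X]; last by rewrite -!mem_column_matroid e.
by apply: val_inj; apply/setP => X; rewrite /= !inE; apply: e.
Qed.

Section Positroids.
Variables (R : realType) (n : nat).
Implicit Types (M : matroid [set: 'I_n]).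

Lemma positroidP M : positroid R M <-> exists d (A : 'M[R]_(d, n)),
  [/\ tnn A, colspan A setT = fullv & M = column_matroid A].
Proof.
split=> -[d [A [H1 H2 ->]]]; exists d, A; split=> //.
- by move=> B /incr_exists[f fi <-]; rewrite minor_incr //; apply: H2.
- exact/colspan_setT.
- exact/colspan_setT.
- move=> f fi; rewrite -minor_incr //; apply: H1.
  by rewrite card_imset ?cardsT ?card_ord //; apply: incr_inj.
Qed.

(** A positroid has many representing matrices; [psi] fixes the decorated permutation of one of
    them. *)
Lemma positroid_decperm : exists psi : matroid [set: 'I_n] -> {ffun 'I_n -> option 'I_n},
  forall M, positroid R M -> exists d (A : 'M[R]_(d, n)),
    [/\ tnn A, colspan A setT = fullv, M = column_matroid A & psi M = decperm A].
Proof.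
apply: (@fin_all_exists _ _ (fun M h => positroid R M -> exists d (A : 'M[R]_(d, n)),
    [/\ tnn A, colspan A setT = fullv, M = column_matroid A & h = decperm A])) => M.
have [/positroidP[d [A [tA fA MA]]]|nM] := pselect (positroid R M).
  by exists (decperm A) => _; exists d, A.
by exists [ffun=> None].
Qed.

(** [psi] is injective by [tnn_unique], surjective by [tnn_exists], and matches connected positroids
    with irreducible decorated permutations. *)
Lemma card_positroids_connected :
  #|positroids R n| = #|decperms n| /\
  #|connected_positroids R n| = #|irreducible_decperms n|.
Proof.
have [psi psiP] := positroid_decperm.
have inj : {in positroids R n &, injective psi}.
  move=> M1 M2; rewrite !inE => /asboolP/psiP[d1 [A1 [t1 f1 -> ->]]].
  move=> /asboolP/psiP[d2 [A2 [t2 f2 -> ->]]] e; apply/eq_column_matroid.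
  exact: (tnn_unique t1 f1 erefl t2 f2 (esym e)).
have surj h : h \in decperms n -> exists2 M, M \in positroids R n & h = psi M.
  move=> /(tnn_exists R)[d [A [tA fA <-]]].
  have pM : positroid R (column_matroid A) by apply/positroidP; exists d, A.
  exists (column_matroid A); first by rewrite inE; apply/asboolP.
  have [d' [A' [_ _ /eq_column_matroid e ->]]] := psiP _ pM.
  exact: eq_decperm.
have psiD M : M \in positroids R n -> psi M \in decperms n.
  by rewrite inE => /asboolP/psiP[d [A [_ _ _ ->]]]; apply: decperm_decperms.
have connP M : M \in positroids R n ->
    (M \in connected_positroids R n) = (psi M \in irreducible_decperms n).
  move=> MP; rewrite [RHS]inE psiD // inE MP /=.
  move: MP; rewrite inE => /asboolP/psiP[d [A [tA fA -> ->]]].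
  by apply/asboolP/(irreducible_onP tA fA) => /connected_column_matroidP.
split.
  rewrite -(card_in_imset inj); apply: eq_card => h; apply/imsetP/idP => [[M MP ->]|/surj//].
  exact: psiD.
have inj' : {in connected_positroids R n &, injective psi}.
  have sub M : M \in connected_positroids R n -> M \in positroids R n.
    by rewrite inE => /andP[].
  by move=> M1 M2 /sub M1P /sub M2P; apply: inj.
rewrite -(card_in_imset inj'); apply: eq_card => h; apply/imsetP/idP => [[M MC ->]|hI].
  by rewrite -connP //; move: MC; rewrite inE => /andP[].
have /surj[M MP hM] : h \in decperms n by move: hI; rewrite inE => /andP[].
by exists M => //; rewrite connP // -hM.
Qed.

End Positroids.

(* These libraries shadow the names of finite set operations used above. *)
From mathcomp Require Import all_classical all_analysis measurable_realfun.
From mathcomp Require Import lra.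

Import numFieldNormedType.Exports.

(** * Moments of the shifted exponential distribution *)

Section ExponentialMoments.
Local Open Scope classical_set_scope.
Variable R : realType.
Notation mu := (@lebesgue_measure R).

(* [- (shifted_primitive n).[x] * expR (- x)] is a primitive of
   [(1 + x) ^+ n * expR (- x)]. *)
Fixpoint shifted_primitive (n : nat) : {poly R} :=
  if n is m.+1 then (1 + 'X) ^+ m.+1 + m.+1%:R *: shifted_primitive m else 1.

Lemma shifted_primitive0 n : (shifted_primitive n).[0] = (\sum_(k < n.+1) n ^_ k)%N%:R.
Proof.
elim: n => [|n IH]; first by rewrite big_ord_recl big_ord0 /= hornerC.
rewrite /= hornerD hornerZ IH horner_exp hornerD hornerC hornerX addr0 expr1n.
rewrite [in RHS]big_ord_recl ffactn0 [in RHS]natrD; congr (_ + _).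
by rewrite -natrM big_distrr.
Qed.

Lemma deriv_shifted_primitive n :
  deriv (shifted_primitive n) = shifted_primitive n - (1 + 'X) ^+ n.
Proof.
elim: n => [|n IH]; first by rewrite /= derivC subrr.
rewrite /= derivD derivZ IH deriv_exp derivD derivX derivC add0r mul1r scalerBr.
by rewrite !scaler_nat /= addrC subrK [RHS]addrAC subrr add0r.
Qed.

Lemma cvg_shifted_exp n : (1 + x) ^+ n * expR (- x) @[x --> +oo] --> (0 : R).
Proof.
(* The exponential at [y = (1 + x) / 2] dominates [y ^+ n.+1] divided by the factorial of [n.+1];
   multiplying by [expR (- x)] leaves the exponent [2^-1 - 2^-1 * x]. *)
pose C : R := 2 ^+ n.+1 * (n.+1)`!%:R * expR 2^-1.
have bound x : 0 <= x -> (1 + x) ^+ n * expR (- x) <= C * expR (- (2^-1 * x)).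
  move=> x0; have y0 : 0 <= (1 + x) / 2 by lra.
  have h := expR_ge1Dxn n y0.
  have h1 : (1 + x) ^+ n <= (1 + x) ^+ n.+1 by rewrite exprS ler_peMl ?exprn_ge0 //; lra.
  have h2 : (1 + x) ^+ n.+1 <= 2 ^+ n.+1 * (n.+1)`!%:R * expR ((1 + x) / 2).
    rewrite -mulrA -ler_pdivrMl ?exprn_gt0 //.
    rewrite [X in _ <= X]mulrC -ler_pdivrMr ?ltr0n ?fact_gt0 //.
    apply: le_trans h; rewrite exprMn exprVn mulrC.
    by rewrite mulrC [2 ^- _ * _]mulrC lerDr ler01.
  apply: le_trans (_ : 2 ^+ n.+1 * (n.+1)`!%:R * expR ((1 + x) / 2) * expR (- x) <= _).
    by rewrite ler_pM2r ?expR_gt0 // (le_trans h1).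
  rewrite -[X in X <= _]mulrA -expRD /C -[X in _ <= X]mulrA -expRD.
  rewrite (_ : (1 + x) / 2 + - x = 2^-1 - 2^-1 * x) //; lra.
apply: (@squeeze_cvgr _ _ _ _ (cst 0) (fun x => C * expR (- (2^-1 * x)))).
- near=> x; have x0 : 0 <= x by near: x; apply: nbhs_pinfty_ge; rewrite num_real.
  rewrite bound // andbT mulr_ge0 ?expR_ge0 // exprn_ge0 //; lra.
- exact: cvg_cst.
- rewrite -[X in _ --> X](mulr0 C); apply: cvgMr.
  apply: (@cvg_comp _ _ _ (fun x : R => 2^-1 * x) (fun z : R => expR (- z)) _
    (pinfty_nbhs R)); last exact: cvgr_expR.
  by apply: gt0_cvgMry => //; rewrite invr_gt0.
Unshelve. all: by end_near. Qed.

Lemma cvg_shifted_primitive n :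
  (shifted_primitive n).[x] * expR (- x) @[x --> +oo] --> (0 : R).
Proof.
elim: n => [|n IH].
  by under eq_fun do rewrite hornerC mul1r; exact: cvgr_expR.
under eq_fun do rewrite /= hornerD hornerZ horner_exp hornerD hornerC hornerX mulrDl -mulrA.
have -> : 0 = 0 + n.+1%:R * 0 :> R by rewrite mulr0 addr0.
by apply: cvgD; [exact: cvg_shifted_exp|apply: cvgMl_tmp; exact: IH].
Qed.

Lemma is_derive_expRN (x : R) : is_derive x 1 (fun x => expR (- x)) (- expR (- x)).
Proof.
have := @is_derive1_comp _ expR -%R x _ _ (is_derive_expR _) (is_deriveNid _ _).
by rewrite mulrN1.
Qed.

Lemma continuous_horner_expRN (p : {poly R}) : continuous (fun x => p.[x] * expR (- x)).
Proof.
move=> x; apply: (@continuousM _ R^o (horner p)); first exact: continuous_horner.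
apply: differentiable_continuous; apply/derivable1_diffP.
by have [] := is_derive_expRN x.
Qed.

Lemma is_derive_shifted n (x : R) :
  is_derive x 1 (fun x => - ((shifted_primitive n).[x] * expR (- x)))
    ((1 + x) ^+ n * expR (- x)).
Proof.
have := is_deriveN (is_deriveM (is_derive_poly (shifted_primitive n) x) (is_derive_expRN x)).
move=> H; apply: (is_derive_eq H).
rewrite deriv_shifted_primitive !hornerE.
rewrite -![_ *: _]/(_ * _); ring.
Qed.

Lemma integral_shifted_exp n :
  (\int[mu]_(x in `[0%R, +oo[) ((1 + x) ^+ n * expR (- x))%:E =
   ((\sum_(k < n.+1) n ^_ k)%N%:R : R)%:E)%E.
Proof.
rewrite (@ge0_continuous_FTC2y _ _ (fun x => - ((shifted_primitive n).[x] * expR (- x))) 0 0).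
- by rewrite oppr0 expR0 mulr1 shifted_primitive0 EFinN oppeK add0e.
- by move=> x x0; rewrite mulr_ge0 ?expR_ge0 // exprn_ge0 //; lra.
- apply: continuous_subspaceT => x.
  have := @continuous_horner_expRN ((1 + 'X) ^+ n) x.
  by under eq_fun do rewrite horner_exp !hornerE.
- by rewrite -oppr0; apply: cvgN; exact: cvg_shifted_primitive.
- by move=> x x0; have [] := is_derive_shifted n x.
- by apply: cvg_at_right_filter; apply: cvgN; exact: continuous_horner_expRN.
- by move=> x _; rewrite derive1E; have [_ ->] := is_derive_shifted n x.
Qed.

End ExponentialMoments.

Section ShiftedExponential.
Local Open Scope classical_set_scope.

(** The density agrees almost everywhere with the Radon-Nikodym derivative, for which the change of
    variables is known. *)
Lemma ge0_integral_density d (T : measurableType d) (R : realType)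
    (nu : {finite_measure set T -> \bar R}) (mu : {sigma_finite_measure set T -> \bar R})
    (f : T -> R) (g : T -> \bar R) :
  (forall x, 0 <= f x) -> measurable_fun [set: T] f ->
  (forall A, measurable A -> nu A = \int[mu]_(x in A) (f x)%:E)%E ->
  (forall x, 0 <= g x)%E -> measurable_fun [set: T] g ->
  (\int[nu]_x g x = \int[mu]_x (g x * (f x)%:E))%E.
Proof.
move=> f0 mf nuE g0 mg.
have dom : nu `<< mu.
  apply/null_content_dominatesP => A mA muA0.
  rewrite nuE //; apply: null_set_integral => //.
  by apply/measurable_EFinP; exact: measurable_funTS.
rewrite -(Radon_Nikodym_SigmaFinite.change_of_variables dom) //.
apply: ae_eq_integral => //.
- apply: emeasurable_funM => //; apply: (measurable_int mu).
  exact: Radon_Nikodym_SigmaFinite.f_integrable.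
- by apply: emeasurable_funM => //; apply/measurable_EFinP.
apply: ae_eqe_mul2l; apply: integral_ae_eq => //.
- exact: Radon_Nikodym_SigmaFinite.f_integrable.
- by apply/measurable_EFinP.
- by move=> E _ mE; rewrite -Radon_Nikodym_SigmaFinite.f_integral // nuE.
Qed.

(* [measurableTypeR R] is [R] with the Borel sets under the display expected by
   [lebesgue_measure]. *)
Lemma expectation_shifted_exponentialR (R : realType) (d : measure_display)
    (T : measurableType d) (P : probability T R) (Z : {RV P >-> measurableTypeR R})
    (hZ : forall A : set (measurableTypeR R), measurable A ->
       distribution P Z A = exponential_prob (1 : R) A) (n : nat) :
  'E_P[fun x => ((1 + (Z x : R)) ^+ n)%R]%E = ((\sum_(k < n.+1) n ^_ k)%N%:R : R)%:E.
Proof.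
(* The absolute value makes the integrand nonnegative also at negative arguments, which [Z] takes
   with probability zero. *)
pose g (x : measurableTypeR R) : R := `|(1 + (x : R)) ^+ n|.
have mZ : measurable_fun [set: T] (fun x => (1 + (Z x : R)) ^+ n).
  by apply: measurable_funX; apply: measurable_funD => //; exact: (@measurable_funPT _ _ _ _ Z).
have mg : measurable_fun [set: measurableTypeR R] g.
  apply: measurableT_comp => //; apply: measurable_funX.
  by apply: measurable_funD => //; exact: measurable_cst.
transitivity (\int[P]_x (g (Z x))%:E)%E.
  rewrite unlock; apply: ae_eq_integral => //; [exact/measurable_EFinP|..].
    by apply/measurable_EFinP; exact: measurableT_comp.
  have P0 : P (Z @^-1` `]-oo, 0[) = 0%E.
    have -> : P (Z @^-1` `]-oo, 0[) = exponential_prob 1 `]-oo, (0 : R)[ by rewrite -hZ.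
    rewrite /exponential_prob integral0_eq // => x /=; rewrite in_itv /= => x0.
    by rewrite lt0_exponential_pdf.
  exists (Z @^-1` `]-oo, 0[); split => //.
    by rewrite -[X in measurable X]setTI; apply: measurable_funPT.
  move=> x /=; apply: contra_notP; rewrite in_itv /= => /negP; rewrite -leNgt => Zx0 _.
  by rewrite /g ger0_norm // exprn_ge0 //; lra.
rewrite -(ge0_integral_distribution Z (f := EFin \o g)); first last.
- by move=> x; rewrite lee_fin normr_ge0.
- exact/measurable_EFinP.
rewrite (@ge0_integral_density _ (measurableTypeR R) _ (distribution P Z)
  (@lebesgue_measure R) (exponential_pdf 1)); first last.
- exact/measurable_EFinP.
- by move=> x; rewrite lee_fin normr_ge0.
- exact: hZ.
- exact: measurable_exponential_pdf.
- by move=> x; exact: exponential_pdf_ge0.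
rewrite -integral_shifted_exp [RHS]integral_mkcond /=.
apply: eq_integral => x _; rewrite patchE mem_setE /= in_itv /= andbT.
have [x0|x0] := leP 0 x; last by rewrite lt0_exponential_pdf // mule0.
rewrite exponential_pdfE // mul1r mulN1r -EFinM /g ger0_norm // exprn_ge0 //; lra.
Qed.

Lemma expectation_shifted_exponential (R : realType) (d : measure_display)
    (T : measurableType d) (P : probability T R) (Z : {RV P >-> R})
    (hZ : forall A : set R, measurable A ->
       distribution P Z A = exponential_prob (1 : R) A) (n : nat) :
  'E_P[fun x => ((1 + Z x) ^+ n)%R]%E = ((\sum_(k < n.+1) n ^_ k)%N%:R : R)%:E.
Proof.
have mZ : measurable_fun [set: T] (Z : T -> measurableTypeR R).
  exact: (@measurable_funPT _ _ _ _ Z).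
pose Z' : {RV P >-> measurableTypeR R} := @mfun_Sub _ _ T (measurableTypeR R) _ (mem_set mZ).
exact: (@expectation_shifted_exponentialR R d T P Z' hZ n).
Qed.

End ShiftedExponential.

Theorem theorem11p1 (R : realType) (d : measure_display) (T : measurableType d)
    (P : probability T R) (Z : {RV P >-> R})
    (hZ : forall A : set R, measurable A ->
       distribution P Z A = exponential_prob (1 : R) A)
    (n : nat) (hn : (0 < n)%N) :
  let Y : T -> R := fun x => 1 + Z x in
  'E_P[fun x => (Y x ^+ n)%R]%E = (#|positroids R n|%:R : R)%:E /\
  free_cumulant (moment P Y) n = #|connected_positroids R n|%:R.
Proof.
move=> Y.
have EY m : 'E_P[fun x => (Y x ^+ m)%R]%E = (#|positroids R m|%:R : R)%:E.
  have [-> _] := card_positroids_connected R m; rewrite card_decperms.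
  exact: (expectation_shifted_exponential hZ m).
split; first exact: EY.
(* Free cumulants are unique, so it suffices to check the moment-cumulant relation, which reduces to
   [card_decperms_NC]. *)
suff fc : is_free_cumulants (moment P Y) (fun m => #|connected_positroids R m|%:R).
  exact: free_cumulants_uniq (free_cumulantP _) fc _ hn.
move=> m m0; rewrite /moment EY /=; have [-> _] := card_positroids_connected R m.
rewrite card_decperms_NC // natr_sum; apply: eq_bigr => Q _.
rewrite natr_prod; apply: eq_bigr => S _.
by have [_ <-] := card_positroids_connected R #|S|.
Qed.
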